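(* The edge generating series of the Motzkin lattices is $$\sum_{n\ge0}\ell(\mathcal{M}_n)x^n=\frac{(1+x)\big(1-2x-x^2-(1-x)\sqrt{1-2x-3x^2}\big)}{2x^2\sqrt{1-2x-3x^2}}.$$ Moreover: (i) for $n\ge1$, $\ell(\mathcal{M}_n)=T_n-M_n+T_{n-1}-M_{n-1}$; (ii) for $n\ge3$, $\ell(\mathcal{M}_n)=[x^{n-2}](1+x+x^2)^n+[x^{n-3}](1+x+x^2)^{n-1}$; (iii) for $n\ge1$, $\ell(\mathcal{M}_n)=\frac2n\sum_{k=0}^{\lfloor n/2\rfloor}\binom nk\binom{n-k}{k}\frac{k(n-k)}{k+1}$. Finally, $\ell(\mathcal{M}_n)\sim \frac{2\cdot3^n}{\sqrt{3n\pi}}$ and $i(\mathcal{M}_n)=\ell(\mathcal{M}_n)/|\mathcal{M}_n|\sim\frac49 n$.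
   Context: Steps: $U=(1,1)$, $D=(1,-1)$, $H=(1,0)$. $\mathcal{M}_n$ is the set of Motzkin paths of length $n$ (lattice paths from $(0,0)$ to $(n,0)$ with steps $U,D,H$ never going below the $x$-axis), partially ordered by $\gamma_1\le\gamma_2$ iff $\gamma_1$ lies weakly below $\gamma_2$. $\ell(P)$ is the number of edges (covering pairs) of the Hasse diagram of a finite poset $P$, and $i(P)=\ell(P)/|P|$. $T_n=[x^n](1+x+x^2)^n$ is the central trinomial coefficient (generating series $1/\sqrt{1-2x-3x^2}$), and $M_n=|\mathcal{M}_n|$ is the $n$-th Motzkin number (generating series $(1-x-\sqrt{1-2x-3x^2})/(2x^2)$). $a_n\sim b_n$ means $a_n/b_n\to1$. *)

(* Defs.v *)
From Stdlib Require Import Reals Lra Lia ZArith Arith List Bool.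
Open Scope bool_scope.
Import ListNotations.

Inductive step : Type := U | D | H.

Definition step_eqb (a b : step) : bool :=
  match a, b with U, U | D, D | H, H => true | _, _ => false end.

Fixpoint path_eqb (p q : list step) : bool :=
  match p, q with
  | [], [] => true
  | a :: p', b :: q' => step_eqb a b && path_eqb p' q'
  | _, _ => false
  end.

Definition step_dh (s : step) : Z :=
  match s with U => 1%Z | D => (-1)%Z | H => 0%Z end.

Definition height (p : list step) (i : nat) : Z :=
  fold_left (fun acc s => (acc + step_dh s)%Z) (firstn i p) 0%Z.

Definition is_motzkin (n : nat) (p : list step) : bool :=
  Nat.eqb (length p) n
  && forallb (fun i => Z.leb 0 (height p i)) (seq 0 (S n))
  && Z.eqb (height p n) 0.

Fixpoint words (n : nat) : list (list step) :=
  match n with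
  | O => [[]]
  | S m => flat_map (fun w => [U :: w; D :: w; H :: w]) (words m)
  end.

(** The (duplicate-free) list of elements of M_n. *)
Definition motz (n : nat) : list (list step) := filter (is_motzkin n) (words n).

Definition Mnum (n : nat) : nat := length (motz n).

(** gamma1 <= gamma2 iff gamma1 lies weakly below gamma2 (compared at the
    integer abscissae 0..n; both are piecewise linear between them). *)
Definition path_le (n : nat) (a b : list step) : bool :=
  forallb (fun i => Z.leb (height a i) (height b i)) (seq 0 (S n)).

Definition path_lt (n : nat) (a b : list step) : bool :=
  path_le n a b && negb (path_eqb a b).

Definition covers (n : nat) (a b : list step) : bool :=
  path_lt n a b
  && negb (existsb (fun c => path_lt n a c && path_lt n c b) (motz n)).

Definition ell (n : nat) : nat :=
  length (filter (fun ab => covers n (fst ab) (snd ab)) (list_prod (motz n) (motz n))).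

(** trin m k = [x^k] (1+x+x^2)^m (coefficient of the expanded product). *)
Fixpoint trin (m k : nat) : nat :=
  match m with
  | O => if Nat.eqb k 0 then 1 else 0
  | S m' => trin m' k
            + (match k with O => 0 | S k1 => trin m' k1 end)
            + (match k with S (S k2) => trin m' k2 | _ => 0 end)
  end.

Definition Tnum (n : nat) : nat := trin n n.

Definition fps := nat -> Z.

Definition fps_mul (f g : fps) : fps :=
  fun k => fold_left (fun acc i => (acc + f i * g (k - i)%nat)%Z) (seq 0 (S k)) 0%Z.

Definition fps_sub (f g : fps) : fps := fun k => (f k - g k)%Z.

Definition fps_poly (l : list Z) : fps := fun k => nth k l 0%Z.

Definition ell_series : fps := fun k => Z.of_nat (ell k).

(* Main.v *)
From Coquelicot Require Import Coquelicot.
Require Import Defs.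
From Stdlib Require Import Reals Lra Lia ZArith Arith List FunctionalExtensionality.
From Stdlib Require FinFun.
Import ListNotations.
Local Open Scope nat_scope.

(** A path [b] covers [a] iff [b] arises from [a] by one of HH -> UD, HU -> UH,
    DH -> HD, DU -> HH.  Inclusion-exclusion over consecutive pairs of steps shows
    that a Motzkin path of length [n >= 1] has (flat steps) + (peaks) - 1 upper covers.
    Both statistics, summed over nonnegative walks from height [h], obey the recursion
    of free walk counts and equal [(h + 1) walks n (h + 1)], with [n] replaced by [n - 1]
    for peaks; with the reflection principle this gives
    [ell n = walks n 2 + walks (n - 1) 2], where [walks n j] is the coefficient of
    [x ^ (n + j)] in [(1 + x + x^2)^n].

    The generating series follows from the first-passage equations
    [M = 1 + x M + x^2 M^2] and [T = 1 + x T + 2 x^2 M T], with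
    [s = 1 - x - 2 x^2 M = 1 / T].

    For the asymptotics, [T_n] is the sum over [k] of [C(n, 2k) C(2k, k)].  Wallis'
    inequalities confine [C(2k, k) / 4^k] closely to [1 / sqrt (PI (k + 1/2))]; the
    tangent-line inequality from below and AM-GM from above turn the inverse square
    root into functions of [k] whose binomial sums have closed forms, so that
    [T_n = sqrt 3 / (2 sqrt (PI n)) 3^n (1 + O(1/n))].  The ballot identity
    [(n + 1) M_n = walks (n + 1) 1] then gives [M_n ~ T_{n+1} / (n + 1)]. *)

(** * Walk counts *)

(** Indexing by all integers frees the recursion and the symmetry under [- j] from boundary
    cases. *)
Fixpoint walks (n : nat) (j : Z) : Z :=
  match n with
  | O => if Z.eqb j 0 then 1 else 0
  | S m => walks m (j + 1) + walks m j + walks m (j - 1)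
  end%Z.

Lemma walks_S n j :
  walks (S n) j = (walks n (j + 1) + walks n j + walks n (j - 1))%Z.
Proof. reflexivity. Qed.

Lemma walks_opp n : forall j, walks n (- j) = walks n j.
Proof.
  induction n as [|n IH]; intro j.
  - simpl. destruct (Z.eqb_spec (- j) 0), (Z.eqb_spec j 0); lia.
  - rewrite !walks_S, <- (IH (j + 1)%Z), <- (IH (j - 1)%Z), (IH j).
    replace (- (j + 1))%Z with (- j - 1)%Z by lia.
    replace (- (j - 1))%Z with (- j + 1)%Z by lia. lia.
Qed.

Lemma walks_out n : forall j, (Z.of_nat n < Z.abs j)%Z -> walks n j = 0%Z.
Proof.
  induction n as [|n IH]; intros j Hj.
  - simpl. destruct (Z.eqb_spec j 0); lia.
  - rewrite walks_S, !IH; lia.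
Qed.

Lemma walks_ge0 n : forall j, (0 <= walks n j)%Z.
Proof.
  induction n as [|n IH]; intro j.
  - simpl. destruct (Z.eqb j 0); lia.
  - rewrite walks_S. generalize (IH (j + 1)%Z) (IH j) (IH (j - 1)%Z). lia.
Qed.

(** The recursion reduces this to comparing [walks n (j + 2)] with [walks n (j - 1)], three
    decreasing steps apart; at [j = 0] the latter equals [walks n 1] by symmetry. *)
Lemma walks_decr n :
  forall j, (0 <= j)%Z -> (walks n (j + 1) <= walks n j)%Z.
Proof.
  induction n as [|n IH]; intros j Hj.
  - simpl. destruct (Z.eqb_spec (j + 1) 0), (Z.eqb_spec j 0); lia.
  - rewrite !walks_S.
    replace (j + 1 - 1)%Z with j by lia.
    assert (walks n (j + 1 + 1) <= walks n (j - 1))%Z; [|lia].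
    assert (A := IH (j + 1)%Z ltac:(lia)). assert (B := IH j Hj).
    destruct (Z.eq_dec j 0) as [->|].
    + rewrite <- (walks_opp n (0 - 1)). simpl in *. lia.
    + assert (D := IH (j - 1)%Z ltac:(lia)).
      replace (j - 1 + 1)%Z with j in D by lia. lia.
Qed.

Lemma trin_walks n :
  forall k, Z.of_nat (trin n k) = walks n (Z.of_nat k - Z.of_nat n).
Proof.
  induction n as [|n IH]; intro k.
  - simpl. destruct k; simpl; [reflexivity|].
    destruct (Z.eqb_spec (Z.pos (Pos.of_succ_nat k) - 0) 0); lia.
  - rewrite walks_S.
    replace (Z.of_nat k - Z.of_nat (S n) + 1)%Z
      with (Z.of_nat k - Z.of_nat n)%Z by lia.
    rewrite <- IH. simpl trin.
    (* For [k] equal to 0 or 1 the terms absent from [trin] are walks farther than [n] from 0, hence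
       zero. *)
    destruct k as [|[|k]].
    + rewrite (walks_out n (Z.of_nat 0 - Z.of_nat (S n))) by lia.
      rewrite walks_out; lia.
    + rewrite (walks_out n (Z.of_nat 1 - Z.of_nat (S n) - 1)) by lia.
      replace (Z.of_nat 1 - Z.of_nat (S n))%Z
        with (Z.of_nat 0 - Z.of_nat n)%Z by lia.
      rewrite <- IH. lia.
    + replace (Z.of_nat (S (S k)) - Z.of_nat (S n) - 1)%Z
        with (Z.of_nat k - Z.of_nat n)%Z by lia.
      replace (Z.of_nat (S (S k)) - Z.of_nat (S n))%Z
        with (Z.of_nat (S k) - Z.of_nat n)%Z by lia.
      rewrite <- !IH. lia.
Qed.

Lemma Tnum_walks n : Z.of_nat (Tnum n) = walks n 0.
Proof. unfold Tnum. rewrite trin_walks. f_equal. lia. Qed.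

Lemma trin_sub_walks n j :
  (j <= n)%nat -> Z.of_nat (trin n (n - j)) = walks n (Z.of_nat j).
Proof.
  intro Hj. rewrite trin_walks, <- walks_opp. f_equal. lia.
Qed.

(** Adding the instances at [j - 1], [j], [j + 1] produces weights [j], [j + 1], [j + 2] instead of
    a uniform [j + 1]; the discrepancy is exactly the one missing copy of the left-hand
    difference. *)
Lemma ballot n : forall j,
  (Z.of_nat (S n) * (walks n j - walks n (j + 2)) = (j + 1) * walks (S n) (j + 1))%Z.
Proof.
  induction n as [|n IH]; intro j.
  - cbn [walks].
    destruct (Z.eqb_spec j 0), (Z.eqb_spec (j + 2) 0),
      (Z.eqb_spec (j + 1 + 1) 0), (Z.eqb_spec (j + 1) 0),
      (Z.eqb_spec (j + 1 - 1) 0); lia.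
  - assert (A := IH (j + 1)%Z). assert (B := IH j). assert (D := IH (j - 1)%Z).
    rewrite (walks_S (S n) (j + 1)), (walks_S n j), (walks_S n (j + 2)).
    assert (E : (walks (S n) (j + 1 + 1)
                 = walks n (j + 1 + 2) + walks n (j + 2) + walks n (j + 1))%Z).
    { rewrite walks_S. replace (j + 1 + 1 + 1)%Z with (j + 1 + 2)%Z by lia.
      replace (j + 1 + 1)%Z with (j + 2)%Z by lia.
      replace (j + 2 - 1)%Z with (j + 1)%Z by lia. reflexivity. }
    assert (F : (walks (S n) (j + 1 - 1)
                 = walks n (j + 1) + walks n j + walks n (j - 1))%Z).
    { rewrite walks_S. replace (j + 1 - 1)%Z with j by lia. reflexivity. }
    replace (j - 1 + 2)%Z with (j + 1)%Z in D by lia.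
    replace (j + 2 + 1)%Z with (j + 1 + 2)%Z by lia.
    replace (j + 2 - 1)%Z with (j + 1)%Z by lia.
    replace (j - 1 + 1)%Z with (j + 1 - 1)%Z in D by lia.
    rewrite (Nat2Z.inj_succ (S n)). lia.
Qed.

(** * The covering relation *)

(** The running height is a parameter so that induction on the word is possible; [h = 0] gives
    Motzkin paths. *)
Fixpoint good (h : Z) (w : list step) : bool :=
  Z.leb 0 h &&
  match w with
  | [] => Z.eqb h 0
  | s :: w' => good (h + step_dh s) w'
  end.

Lemma height_0 p : height p 0 = 0%Z.
Proof. reflexivity. Qed.

Lemma fold_steps l : forall x,
  fold_left (fun acc s => (acc + step_dh s)%Z) l x
  = (x + fold_left (fun acc s => (acc + step_dh s)%Z) l 0)%Z.
Proof.
  induction l as [|s l IH]; intro x; cbn [fold_left].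
  - lia.
  - rewrite IH, (IH (0 + step_dh s)%Z). lia.
Qed.

Lemma height_cons s p i : height (s :: p) (S i) = (step_dh s + height p i)%Z.
Proof.
  unfold height. rewrite firstn_cons. cbn [fold_left].
  rewrite fold_steps. lia.
Qed.

Lemma good_spec w : forall h,
  good h w = true <->
  (forall i, (i <= length w)%nat -> (0 <= h + height w i)%Z) /\
  (h + height w (length w) = 0)%Z.
Proof.
  induction w as [|s w IH]; intro h; cbn [good length].
  - rewrite Bool.andb_true_iff, Z.leb_le, Z.eqb_eq, height_0. split.
    + intros [A B]. split; [|lia]. intros i Hi.
      replace i with 0%nat by lia. rewrite height_0. lia.
    + intros [A B]. specialize (A 0%nat ltac:(lia)). rewrite height_0 in A. lia.
  - rewrite Bool.andb_true_iff, Z.leb_le, IH, height_cons. split.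
    + intros [A [B E]]. split; [|lia]. intros [|i] Hi.
      * rewrite height_0. lia.
      * rewrite height_cons. specialize (B i ltac:(lia)). lia.
    + intros [A B]. repeat split; [| |lia].
      * specialize (A 0%nat ltac:(lia)). rewrite height_0 in A. lia.
      * intros i Hi. specialize (A (S i) ltac:(lia)). rewrite height_cons in A. lia.
Qed.

Lemma forallb_seq_iff f n :
  forallb f (seq 0 (S n)) = true <-> forall i, (i <= n)%nat -> f i = true.
Proof.
  rewrite forallb_forall. split; intros A i Hi; apply A.
  - apply in_seq. lia.
  - apply in_seq in Hi. lia.
Qed.

Lemma is_motzkin_good n w :
  is_motzkin n w = true <-> length w = n /\ good 0 w = true.
Proof.
  unfold is_motzkin.
  rewrite !Bool.andb_true_iff, Nat.eqb_eq, forallb_seq_iff, Z.eqb_eq, good_spec.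
  split.
  - intros [[<- A] B]. repeat split; [|lia].
    intros i Hi. specialize (A i Hi). apply Z.leb_le in A. lia.
  - intros [<- [A B]]. repeat split; [|lia].
    intros i Hi. apply Z.leb_le. specialize (A i Hi). lia.
Qed.

Lemma in_words n : forall w, In w (words n) <-> length w = n.
Proof.
  induction n as [|n IH]; intro w; cbn [words].
  - split; [intros [<-|[]]; reflexivity|].
    destruct w; [left; reflexivity|discriminate].
  - rewrite in_flat_map. split.
    + intros [v [Hv Hw]]. apply IH in Hv.
      destruct Hw as [<-|[<-|[<-|[]]]]; simpl; lia.
    + destruct w as [|s w]; [discriminate|]. intro Hw. exists w.
      split; [apply IH; simpl in Hw; lia|].
      destruct s; simpl; auto.
Qed.

Lemma NoDup_words n : NoDup (words n).
Proof.
  induction n as [|n IH]; cbn [words].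
  - constructor; [intros []|constructor].
  - induction IH as [|w l Hw _ IHl]; [constructor|].
    assert (A : forall s, ~ In (s :: w)
                (flat_map (fun w => [U :: w; D :: w; H :: w]) l)).
    { intros s Hs. apply in_flat_map in Hs. destruct Hs as [v [Hv Hs]].
      apply Hw. destruct Hs as [E|[E|[E|[]]]]; injection E; intros; subst; auto. }
    cbn [flat_map app].
    repeat constructor; trivial; intro B; simpl in B;
      repeat (destruct B as [B|B]; [discriminate|]); eapply A; exact B.
Qed.

Lemma in_motz n w : In w (motz n) <-> length w = n /\ good 0 w = true.
Proof.
  unfold motz. rewrite filter_In, in_words, is_motzkin_good. tauto.
Qed.

Lemma NoDup_motz n : NoDup (motz n).
Proof. apply NoDup_filter, NoDup_words. Qed.

(* [wle d a b]: [b], started [d] above [a], stays weakly above [a] and ends at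
   the same height. *)
Fixpoint wle (d : Z) (a b : list step) : Prop :=
  (0 <= d)%Z /\
  match a, b with
  | [], [] => d = 0%Z
  | s :: a', t :: b' => wle (d + step_dh t - step_dh s) a' b'
  | _, _ => False
  end.

Lemma wle_spec a : forall d b, length a = length b ->
  (wle d a b <->
   (forall i, (i <= length a)%nat -> (0 <= d + height b i - height a i)%Z) /\
   (d + height b (length b) - height a (length a) = 0)%Z).
Proof.
  induction a as [|s a IH]; intros d [|t b] L; try discriminate L;
    cbn [wle length].
  - rewrite !height_0. split.
    + intros [A B]. split; [|lia]. intros i Hi.
      replace i with 0%nat by lia. rewrite height_0. lia.
    + intros [A B]. specialize (A 0%nat ltac:(lia)). rewrite height_0 in A. lia.
  - injection L as L. rewrite (IH _ _ L), !height_cons. split.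
    + intros [A [B E]]. split; [|lia]. intros [|i] Hi.
      * rewrite !height_0. lia.
      * rewrite !height_cons. specialize (B i ltac:(lia)). lia.
    + intros [A B]. repeat split; [| |lia].
      * specialize (A 0%nat ltac:(lia)). rewrite !height_0 in A. lia.
      * intros i Hi. specialize (A (S i) ltac:(lia)). rewrite !height_cons in A. lia.
Qed.

Lemma path_eqb_eq a : forall b, path_eqb a b = true <-> a = b.
Proof.
  induction a as [|s a IH]; intros [|t b]; cbn [path_eqb].
  1-3: split; congruence.
  rewrite Bool.andb_true_iff, IH. split.
  - intros [A ->]. destruct s, t; simpl in A; congruence.
  - intro E. injection E as -> ->. destruct t; auto.
Qed.

Lemma path_lt_motz n a b : In a (motz n) -> In b (motz n) ->
  (path_lt n a b = true <-> wle 0 a b /\ a <> b).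
Proof.
  rewrite !in_motz. intros [La Ga] [Lb Gb].
  apply good_spec in Ga, Gb. rewrite La in Ga. rewrite Lb in Gb.
  unfold path_lt, path_le.
  rewrite Bool.andb_true_iff, forallb_seq_iff, Bool.negb_true_iff,
    wle_spec, La, Lb, <- Bool.not_true_iff_false, path_eqb_eq by congruence.
  split; intros [A B]; (split; [|exact B]).
  - split; [|lia]. intros i Hi. specialize (A i Hi). apply Z.leb_le in A. lia.
  - destruct A as [A _]. intros i Hi. apply Z.leb_le. specialize (A i Hi). lia.
Qed.

Lemma wle_refl a : wle 0 a a.
Proof.
  induction a as [|s a IH]; cbn [wle]; (split; [lia|]); trivial.
  now replace (0 + step_dh s - step_dh s)%Z with 0%Z by lia.
Qed.

(** The heights of [b] are those of [a] plus a nonnegative gap. This keeps raised paths inside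
    [motz n]. *)
Lemma good_wle a : forall h d b,
  good h a = true -> wle d a b -> good (h + d) b = true.
Proof.
  induction a as [|s a IH]; intros h d [|t b]; cbn [good wle];
    rewrite ?Bool.andb_true_iff, ?Z.leb_le, ?Z.eqb_eq; try tauto.
  - lia.
  - intros [A B] [E F]. split; [lia|].
    specialize (IH _ _ _ B F).
    now replace (h + d + step_dh t)%Z
      with (h + step_dh s + (d + step_dh t - step_dh s))%Z by lia.
Qed.

(** * Raising one vertex of a path *)

Definition step_up (s : step) : step := match s with D => H | _ => U end.
Definition step_down (s : step) : step := match s with U => H | _ => D end.

Definition raisable (s t : step) : bool :=
  negb (step_eqb s U) && negb (step_eqb t D).

Fixpoint raises (w : list step) : list (list step) :=
  match w with
  | s :: w' =>
      match w' with
      | t :: v => if raisable s t then [step_up s :: step_down t :: v] else []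
      | [] => []
      end ++ map (cons s) (raises w')
  | [] => []
  end.

Lemma raisable_dh s t : raisable s t = true ->
  step_dh (step_up s) = (step_dh s + 1)%Z /\ step_dh (step_down t) = (step_dh t - 1)%Z.
Proof. destruct s, t; simpl; (discriminate || lia). Qed.

(** Induction on the number of steps before the raised pair. *)
Lemma raises_ind (P : list step -> list step -> Prop) :
  (forall s t v, raisable s t = true ->
     P (s :: t :: v) (step_up s :: step_down t :: v)) ->
  (forall s a b, In b (raises a) -> P a b -> P (s :: a) (s :: b)) ->
  forall a b, In b (raises a) -> P a b.
Proof.
  intros P1 P2. induction a as [|s a IH]; intros b Hb; [destruct Hb|].
  cbn [raises] in Hb. apply in_app_or in Hb. destruct Hb as [Hb|Hb].
  - destruct a as [|t v]; [destruct Hb|].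
    destruct (raisable s t) eqn:R; [|destruct Hb].
    destruct Hb as [<-|[]]. auto.
  - apply in_map_iff in Hb. destruct Hb as [c [<- Hc]]. auto.
Qed.

Lemma wle_raise a b : In b (raises a) -> wle 0 a b.
Proof.
  revert a b. apply raises_ind.
  - intros s t v R. apply raisable_dh in R. destruct R as [R1 R2].
    cbn [wle]. rewrite R1, R2.
    split; [lia|]. split; [lia|].
    replace (0 + (step_dh s + 1) - step_dh s + (step_dh t - 1) - step_dh t)%Z
      with 0%Z by lia. apply wle_refl.
  - intros s a b _ A. cbn [wle]. split; [lia|].
    now replace (0 + step_dh s - step_dh s)%Z with 0%Z by lia.
Qed.

(** Serves as a rank function: strictly increasing in the order, and increased by exactly one by a
    raise. The final height is omitted, since compared paths share it. *)
Fixpoint area (h : Z) (w : list step) : Z :=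
  match w with
  | [] => 0
  | s :: w' => (h + area (h + step_dh s) w')%Z
  end.

Lemma area_raise a b :
  In b (raises a) -> forall h, area h b = (area h a + 1)%Z.
Proof.
  revert a b. apply (raises_ind (fun a b => forall h, area h b = (area h a + 1)%Z)).
  - intros s t v R h. apply raisable_dh in R. destruct R as [R1 R2].
    cbn [area]. rewrite R1, R2.
    replace (h + (step_dh s + 1) + (step_dh t - 1))%Z
      with (h + step_dh s + step_dh t)%Z by lia. lia.
  - intros s a b _ A h. cbn [area]. rewrite A. lia.
Qed.

Lemma step_dh_inj s t : step_dh s = step_dh t -> s = t.
Proof. destruct s, t; simpl; (reflexivity || discriminate). Qed.

(** The two areas differ by the sum of the vertical gaps, all nonnegative, so equality forces every
    gap to be zero. *)
Lemma area_wle a : forall h d b, wle d a b ->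
  (area h a <= area (h + d) b)%Z /\
  (area h a = area (h + d) b -> d = 0%Z /\ a = b).
Proof.
  induction a as [|s a IH]; intros h d [|t b]; cbn [area wle]; try tauto.
  - intros [A B]. split; [lia|auto].
  - intros [A B]. destruct (IH (h + step_dh s)%Z _ _ B) as [E F].
    replace (h + step_dh s + (d + step_dh t - step_dh s))%Z
      with (h + d + step_dh t)%Z in * by lia.
    split; [lia|]. intros G. destruct F as [F1 F2]; [lia|].
    split; [lia|]. rewrite F2. f_equal. apply step_dh_inj. lia.
Qed.

(* A strict inequality [a < b] starts with a step of [a] below that of [b].
   Past it, either [a] can be raised right there or it keeps going down while
   [b] stays strictly above, which cannot last until the common endpoint. *)
Lemma raise_below_aux a : forall d b, (0 < d)%Z -> wle d a b ->
  (exists t v, a = t :: v /\ t <> D) \/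
  (exists c, In c (raises a) /\ wle d c b).
Proof.
  induction a as [|t v IH]; intros d b Hd A; destruct b as [|t' b];
    cbn [wle] in A; try tauto; [lia|].
  destruct A as [_ A].
  destruct (step_eqb t D) eqn:E.
  2: { left. exists t, v. split; [reflexivity|]. intros ->. discriminate. }
  assert (t = D) as -> by (destruct t; (reflexivity || discriminate)).
  right.
  (* No step of [b] descends faster than [D], so the gap stays positive. *)
  assert (Hd2 : (0 < d + step_dh t' - step_dh D)%Z) by (destruct t'; simpl; lia).
  destruct (IH _ _ Hd2 A) as [[t2 [v2 [-> N]]]|[c [Hc Wc]]].
  - exists (step_up D :: step_down t2 :: v2). split.
    + cbn [raises]. apply in_or_app. left.
      destruct t2; simpl; auto; congruence.
    + destruct b as [|t3 b]; cbn [wle] in A |- *; [tauto|].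
      destruct A as [A1 A2]. split; [lia|].
      assert (R : step_dh (step_down t2) = (step_dh t2 - 1)%Z)
        by (destruct t2; simpl; congruence || lia).
      split; [simpl in *; lia|].
      rewrite R. simpl (step_dh (step_up D)). simpl (step_dh D) in A2.
      now replace (d + step_dh t' - 0 + step_dh t3 - (step_dh t2 - 1))%Z
        with (d + step_dh t' - -1 + step_dh t3 - step_dh t2)%Z by lia.
  - exists (D :: c). split.
    + cbn [raises]. apply in_or_app. right. now apply in_map.
    + cbn [wle]. split; [lia|trivial].
Qed.

(** The previous lemma is applied after the first step where [b] rises above [a]. Consequently upper
    covers of [a] can only be raises. *)
Lemma raise_below a : forall b, wle 0 a b -> a <> b ->
  exists c, In c (raises a) /\ wle 0 c b.
Proof.
  induction a as [|s a IH]; intros [|t b]; cbn [wle]; try tauto.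
  intros [_ A] N.
  assert (Hd : (0 <= 0 + step_dh t - step_dh s)%Z) by (destruct a; apply A).
  destruct (Z.eq_dec (0 + step_dh t - step_dh s) 0) as [Z0|NZ].
  - assert (s = t) as -> by (apply step_dh_inj; lia).
    rewrite Z0 in A. destruct (IH b A) as [c [Hc Wc]]; [congruence|].
    exists (t :: c). split.
    + cbn [raises]. apply in_or_app. right. now apply in_map.
    + cbn [wle]. rewrite Z0. split; [lia|trivial].
  - assert (Hd2 : (0 < 0 + step_dh t - step_dh s)%Z) by lia.
    destruct (raise_below_aux a _ _ Hd2 A) as [[t2 [v2 [-> N2]]]|[c [Hc Wc]]].
    + exists (step_up s :: step_down t2 :: v2).
      (* [s] cannot be [U], because the step of [b] has strictly larger slope. *)
      assert (R : raisable s t2 = true).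
      { destruct s, t2; simpl; try reflexivity; try congruence;
          destruct t; simpl in Hd2; lia. }
      split; [cbn [raises]; apply in_or_app; left; rewrite R; now left|].
      apply raisable_dh in R. destruct R as [R1 R2].
      destruct b as [|t3 b]; cbn [wle] in A |- *; [tauto|].
      destruct A as [A1 A2]. rewrite R1, R2.
      split; [lia|]. split; [lia|].
      now replace (0 + step_dh t - (step_dh s + 1) + step_dh t3 - (step_dh t2 - 1))%Z
        with (0 + step_dh t - step_dh s + step_dh t3 - step_dh t2)%Z by lia.
    + exists (s :: c). split.
      * cbn [raises]. apply in_or_app. right. now apply in_map.
      * cbn [wle]. split; [lia|trivial].
Qed.

Lemma length_raise a b : In b (raises a) -> length b = length a.
Proof.
  revert a b. apply (raises_ind (fun a b => length b = length a)); simpl; auto.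
Qed.

Lemma raise_motz n a b : In a (motz n) -> In b (raises a) -> In b (motz n).
Proof.
  rewrite !in_motz. intros [L G] Hb. split.
  - now rewrite (length_raise a b Hb).
  - exact (good_wle a 0 0 b G (wle_raise a b Hb)).
Qed.

Lemma raise_neq a b : In b (raises a) -> a <> b.
Proof. intros Hb E. assert (A := area_raise a b Hb 0). subst. lia. Qed.

(** Below a cover [b] lies some raise [c] of [a], forcing [c = b]. Conversely, a path strictly
    between [a] and a raise would have its area strictly between two consecutive integers. *)
Lemma covers_raises n a b : In a (motz n) ->
  (In b (motz n) /\ covers n a b = true <-> In b (raises a)).
Proof.
  intro Ha. unfold covers.
  rewrite Bool.andb_true_iff, Bool.negb_true_iff, <- Bool.not_true_iff_false,
    existsb_exists.
  split.
  - intros [Hb [L N]]. apply path_lt_motz in L as [W E]; trivial.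
    destruct (raise_below a b W E) as [c [Hc Wc]].
    assert (Mc := raise_motz n a c Ha Hc).
    destruct (path_eqb c b) eqn:Q; [apply path_eqb_eq in Q; now subst|].
    assert (NE : c <> b) by (rewrite <- path_eqb_eq; congruence).
    exfalso. apply N. exists c. split; trivial.
    apply Bool.andb_true_iff. split; apply path_lt_motz; trivial; split; trivial.
    + now apply wle_raise.
    + now apply raise_neq.
  - intro Hb. assert (Mb := raise_motz n a b Ha Hb).
    split; trivial. split.
    + apply path_lt_motz; trivial. split; [now apply wle_raise|now apply raise_neq].
    + intros [c [Mc L]]. apply Bool.andb_true_iff in L as [L1 L2].
      apply path_lt_motz in L1 as [W1 E1]; trivial.
      apply path_lt_motz in L2 as [W2 E2]; trivial.
      destruct (area_wle a 0 0 c W1) as [A1 B1].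
      destruct (area_wle c 0 0 b W2) as [A2 B2].
      assert (A := area_raise a b Hb 0).
      simpl (0 + 0)%Z in *.
      destruct (Z.eq_dec (area 0 a) (area 0 c)) as [e|]; [now destruct (B1 e)|].
      destruct (Z.eq_dec (area 0 c) (area 0 b)) as [e|]; [now destruct (B2 e)|].
      lia.
Qed.

Lemma NoDup_raises a : NoDup (raises a).
Proof.
  induction a as [|s a IH]; [constructor|].
  assert (M : NoDup (map (cons s) (raises a))).
  { apply FinFun.Injective_map_NoDup; trivial. intros x y E. congruence. }
  cbn [raises]. destruct a as [|t v]; trivial.
  destruct (raisable s t) eqn:R; trivial.
  (* A raise of the first pair changes the leading step, which all other raises keep. *)
  constructor; trivial. intro I. apply in_map_iff in I as [c [E _]].
  injection E. destruct s; simpl; discriminate.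
Qed.

Lemma length_list_prod_filter {A B} (f : A * B -> bool) l l' :
  length (filter f (list_prod l l'))
  = list_sum (map (fun a => length (filter (fun b => f (a, b)) l')) l).
Proof.
  induction l as [|a l IH]; [reflexivity|].
  cbn [list_prod map list_sum fold_right].
  rewrite filter_app, length_app, IH. f_equal.
  clear. induction l' as [|b l' IH]; [reflexivity|].
  cbn [map filter]. destruct (f (a, b)); simpl; now rewrite IH.
Qed.

Lemma ell_raises n : ell n = list_sum (map (fun a => length (raises a)) (motz n)).
Proof.
  unfold ell. rewrite length_list_prod_filter. f_equal.
  apply map_ext_in. intros a Ha.
  apply Nat.le_antisymm; apply NoDup_incl_length;
    try apply NoDup_raises; try apply NoDup_filter, NoDup_motz;
    intros b Hb.
  - apply filter_In in Hb. now apply (covers_raises n).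
  - apply filter_In. now apply covers_raises.
Qed.

(** * Counting edges *)

Definition wsum (n : nat) (F : list step -> Z) : Z :=
  fold_right Z.add 0%Z (map F (words n)).

Lemma wsum_S n F :
  wsum (S n) F = wsum n (fun w => F (U :: w) + F (D :: w) + F (H :: w))%Z.
Proof.
  unfold wsum. cbn [words]. induction (words n) as [|w l IH]; [reflexivity|].
  cbn [flat_map app map fold_right]. rewrite IH. lia.
Qed.

Lemma wsum_ext n F G :
  (forall w, length w = n -> F w = G w) -> wsum n F = wsum n G.
Proof.
  intro E. unfold wsum. f_equal. apply map_ext_in.
  intros w Hw. apply E. now apply in_words.
Qed.

Lemma wsum_add n F G : wsum n (fun w => F w + G w)%Z = (wsum n F + wsum n G)%Z.
Proof.
  unfold wsum. induction (words n) as [|w l IH]; [reflexivity|].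
  cbn [map fold_right]. rewrite IH. lia.
Qed.

Lemma wsum_0 n : wsum n (fun _ => 0%Z) = 0%Z.
Proof.
  unfold wsum. induction (words n) as [|w l IH]; [reflexivity|].
  cbn [map fold_right]. rewrite IH. lia.
Qed.

(** A sum over the nonnegative walks from [h] to 0; the variable start closes the recursion on the
    first step. *)
Definition gsum (n : nat) (h : Z) (F : list step -> Z) : Z :=
  wsum n (fun w => if good h w then F w else 0%Z).

Lemma gsum_S n h F : (0 <= h)%Z ->
  gsum (S n) h F =
  (gsum n (h + 1) (fun w => F (U :: w)) + gsum n h (fun w => F (H :: w))
   + gsum n (h - 1) (fun w => F (D :: w)))%Z.
Proof.
  intro Hh. unfold gsum. rewrite wsum_S, <- !wsum_add. apply wsum_ext.
  intros w _. cbn [good step_dh].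
  replace (0 <=? h)%Z with true by (symmetry; apply Z.leb_le; lia).
  cbn [andb]. rewrite Z.add_0_r.
  replace (h + -1)%Z with (h - 1)%Z by lia. lia.
Qed.

Lemma gsum_neg n h F : (h < 0)%Z -> gsum n h F = 0%Z.
Proof.
  intro Hh. transitivity (wsum n (fun _ => 0%Z)); [|apply wsum_0].
  apply wsum_ext. intros w _.
  replace (good h w) with false; trivial.
  destruct w; cbn [good];
    (replace (0 <=? h)%Z with false by (symmetry; apply Z.leb_gt; lia)); reflexivity.
Qed.

Lemma gsum_ext n h F G :
  (forall w, length w = n -> good h w = true -> F w = G w) -> gsum n h F = gsum n h G.
Proof.
  intro E. apply wsum_ext. intros w L.
  destruct (good h w) eqn:Q; auto.
Qed.

Lemma gsum_add n h F G : gsum n h (fun w => F w + G w)%Z = (gsum n h F + gsum n h G)%Z.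
Proof.
  unfold gsum. rewrite <- wsum_add. apply wsum_ext.
  intros w _. destruct (good h w); lia.
Qed.

Lemma gsum_0 n h : gsum n h (fun _ => 0%Z) = 0%Z.
Proof.
  transitivity (wsum n (fun _ => 0%Z)); [|apply wsum_0].
  apply wsum_ext. intros w _. now destruct (good h w).
Qed.

(** Counts nonnegative walks from [h] to 0: reflecting at height -1 the walks that reach it gives
    all walks from [- h - 2], of which there are [walks n (h + 2)]. *)
Definition motzkin_walks (n : nat) (h : Z) : Z := (walks n h - walks n (h + 2))%Z.

Lemma motzkin_walks_S n h : (0 <= h)%Z ->
  motzkin_walks (S n) h =
  (motzkin_walks n (h + 1) + motzkin_walks n h + motzkin_walks n (h - 1))%Z.
Proof.
  intro Hh. unfold motzkin_walks. rewrite !walks_S.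
  replace (h + 2 - 1)%Z with (h + 1)%Z by lia.
  replace (h - 1 + 2)%Z with (h + 1)%Z by lia.
  replace (h + 2 + 1)%Z with (h + 1 + 2)%Z by lia. lia.
Qed.

Lemma motzkin_walks_m1 n : motzkin_walks n (-1) = 0%Z.
Proof. unfold motzkin_walks. assert (A := walks_opp n 1). simpl in *. lia. Qed.

(* The reflection principle. *)
Lemma gsum_1 n : forall h, (-1 <= h)%Z -> gsum n h (fun _ => 1%Z) = motzkin_walks n h.
Proof.
  induction n as [|n IH]; intros h Hh;
    (destruct (Z.eq_dec h (-1)) as [->|]; [rewrite motzkin_walks_m1; apply gsum_neg; lia|]).
  - unfold gsum, wsum, motzkin_walks. cbn.
    destruct (Z.leb_spec 0 h), (Z.eqb_spec h 0), (Z.eqb_spec (h + 2) 0); simpl; lia.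
  - rewrite gsum_S, !IH, motzkin_walks_S; lia.
Qed.

(** * Flat steps and peaks *)

Definition flats (w : list step) : Z :=
  fold_right (fun s acc => (if step_eqb s H then 1 else 0) + acc)%Z 0%Z w.

Definition starts_with (s : step) (w : list step) : Z :=
  match w with t :: _ => if step_eqb s t then 1 else 0 | [] => 0 end%Z.

Fixpoint peaks (w : list step) : Z :=
  match w with
  | [] => 0
  | s :: w' => ((if step_eqb s U then starts_with D w' else 0) + peaks w')%Z
  end.

Fixpoint ends_up (w : list step) : Z :=
  match w with
  | [] => 0
  | [s] => if step_eqb s U then 1 else 0
  | _ :: w' => ends_up w'
  end%Z.

(* Of the [n - 1] pairs of consecutive steps, discard those starting with [U]
   or ending with [D]; inclusion-exclusion. *)
Lemma length_raises w : w <> [] ->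
  (Z.of_nat (length (raises w)) + 1
   = flats w + peaks w + starts_with D w + ends_up w)%Z.
Proof.
  induction w as [|s w IH]; [congruence|]. intros _.
  destruct w as [|t w].
  - destruct s; reflexivity.
  - specialize (IH ltac:(congruence)).
    set (v := t :: w) in *.
    assert (L : (Z.of_nat (length (raises (s :: v)))
       = (if raisable s t then 1 else 0) + Z.of_nat (length (raises v)))%Z).
    { unfold v. cbn [raises]. rewrite length_app, length_map.
      destruct (raisable s t); cbn [length]; lia. }
    rewrite L.
    assert (E : ends_up (s :: v) = ends_up v) by reflexivity.
    rewrite E. cbn [flats fold_right peaks].
    change (fold_right (fun s acc => ((if step_eqb s H then 1 else 0) + acc)%Z) 0%Z v)
      with (flats v).
    assert (Sv : starts_with D v = if step_eqb D t then 1%Z else 0%Z) by reflexivity.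
    rewrite Sv in *. clearbody v.
    destruct s, t; cbn [raisable step_eqb negb andb starts_with] in *; lia.
Qed.

(** A final [U] ending at height 0 would start from -1. *)
Lemma good_ends_up w : forall h, good h w = true -> ends_up w = 0%Z.
Proof.
  induction w as [|s w IH]; intros h; [reflexivity|].
  cbn [good]. rewrite Bool.andb_true_iff, Z.leb_le. intros [A B].
  destruct w as [|t w].
  - destruct s; trivial. cbn in B.
    rewrite Bool.andb_true_iff, Z.leb_le, Z.eqb_eq in B. lia.
  - exact (IH _ B).
Qed.

Lemma good_starts_down w : good 0 w = true -> starts_with D w = 0%Z.
Proof.
  destruct w as [|s w]; [reflexivity|].
  destruct s; try reflexivity. destruct w; discriminate.
Qed.

(** In the first-step recursion the sums from [h + 1], [h], [h - 1] carry factors [h + 2], [h + 1],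
    [h]. The walks starting with [H] add [motzkin_walks n h], which evens these out to [h + 1]. *)
Lemma gsum_flats n : forall h, (-1 <= h)%Z ->
  gsum n h flats = ((h + 1) * walks n (h + 1))%Z.
Proof.
  induction n as [|n IH]; intros h Hh;
    (destruct (Z.eq_dec h (-1)) as [->|]; [apply gsum_neg; lia|]).
  - unfold gsum, wsum. cbn -[Z.mul].
    destruct (0 <=? h)%Z, (h =? 0)%Z, (Z.eqb_spec (h + 1) 0); simpl; lia.
  - rewrite gsum_S by lia.
    change (fun w => flats (U :: w)) with (fun w => 0 + flats w)%Z.
    change (fun w => flats (D :: w)) with (fun w => 0 + flats w)%Z.
    change (fun w => flats (H :: w)) with (fun w => 1 + flats w)%Z.
    rewrite !gsum_add, !gsum_0, !IH, gsum_1 by lia. unfold motzkin_walks.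
    rewrite walks_S.
    replace (h + 1 + 1)%Z with (h + 2)%Z by lia.
    replace (h + 1 - 1)%Z with h by lia.
    replace (h - 1 + 1)%Z with h by lia. lia.
Qed.

(** Contracting a marked peak [UD] to a marked [H] shortens the walk by one, which explains the
    shift from [gsum_flats]. The recursion is the same, with an initial [UD] contributing
    [motzkin_walks n h]. *)
Lemma gsum_peaks n : forall h, (-1 <= h)%Z ->
  gsum (S n) h peaks = ((h + 1) * walks n (h + 1))%Z.
Proof.
  induction n as [|n IH]; intros h Hh;
    (destruct (Z.eq_dec h (-1)) as [->|]; [apply gsum_neg; lia|]).
  - rewrite gsum_S by lia. unfold gsum, wsum. cbn -[Z.mul Z.add].
    destruct (Z.eqb_spec (h + 1) 0); [lia|].
    destruct (_ && _), (_ && _), (_ && _); simpl; lia.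
  - rewrite gsum_S by lia.
    change (fun w => peaks (U :: w)) with (fun w => starts_with D w + peaks w)%Z.
    change (fun w => peaks (D :: w)) with (fun w => 0 + peaks w)%Z.
    change (fun w => peaks (H :: w)) with (fun w => 0 + peaks w)%Z.
    rewrite !gsum_add, !gsum_0, !IH by lia.
    rewrite gsum_S by lia.
    change (fun w => starts_with D (U :: w)) with (fun _ : list step => 0%Z).
    change (fun w => starts_with D (H :: w)) with (fun _ : list step => 0%Z).
    change (fun w => starts_with D (D :: w)) with (fun _ : list step => 1%Z).
    rewrite !gsum_0, gsum_1 by lia. unfold motzkin_walks. rewrite walks_S.
    replace (h + 1 + 1)%Z with (h + 2)%Z by lia.
    replace (h + 1 - 1)%Z with h by lia.
    replace (h - 1 + 1)%Z with h by lia. lia.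
Qed.

Lemma sum_motz n (f : list step -> nat) :
  Z.of_nat (list_sum (map f (motz n))) = gsum n 0 (fun w => Z.of_nat (f w)).
Proof.
  unfold gsum, wsum, motz.
  assert (L : forall w, In w (words n) -> length w = n) by (intro; apply in_words).
  induction (words n) as [|w l IH]; [reflexivity|].
  cbn [filter map fold_right]. rewrite <- IH by auto with datatypes.
  destruct (good 0 w) eqn:G.
  - replace (is_motzkin n w) with true
      by (symmetry; apply is_motzkin_good; auto with datatypes).
    cbn [map list_sum fold_right]. fold (list_sum (map f (filter (is_motzkin n) l))). lia.
  - replace (is_motzkin n w) with false; [lia|].
    symmetry. apply Bool.not_true_iff_false. rewrite is_motzkin_good. intuition congruence.
Qed.

Lemma Mnum_walks n : Z.of_nat (Mnum n) = motzkin_walks n 0.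
Proof.
  rewrite <- gsum_1 by lia. change 1%Z with (Z.of_nat 1).
  rewrite <- (sum_motz n (fun _ => 1%nat)). f_equal.
  unfold Mnum. induction (motz n) as [|w l IH]; [reflexivity|]. simpl. now rewrite IH.
Qed.

(** Summing [length_raises] over all paths gives [ell (S n) + Mnum (S n) = walks (S n) 1 + walks n
    1]; the one-step recursion and symmetry do the rest. *)
Lemma ell_walks n : Z.of_nat (ell (S n)) = (walks (S n) 2 + walks n 2)%Z.
Proof.
  assert (E : gsum (S n) 0 (fun w => Z.of_nat (length (raises w)) + 1)%Z
              = gsum (S n) 0 (fun w => flats w + peaks w)%Z).
  { apply gsum_ext. intros w L G.
    rewrite length_raises, (good_ends_up w 0), good_starts_down; trivial; [lia|].
    intros ->. discriminate. }
  rewrite !gsum_add, gsum_flats, gsum_peaks, gsum_1 in E by lia.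
  rewrite ell_raises, sum_motz. unfold motzkin_walks in E. simpl (0 + _)%Z in E.
  assert (A := walks_S n 0). assert (B := walks_S n 1). simpl (0 + _)%Z in A.
  assert (O := walks_opp n 1). simpl (0 - 1)%Z in A. simpl (- (1))%Z in O.
  simpl (1 + 1)%Z in B. simpl (1 - 1)%Z in B. lia.
Qed.

Lemma ell_trinomial n : (1 <= n)%nat ->
  Z.of_nat (ell n) =
  (Z.of_nat (Tnum n) - Z.of_nat (Mnum n)
   + Z.of_nat (Tnum (n - 1)) - Z.of_nat (Mnum (n - 1)))%Z.
Proof.
  destruct n as [|n]; [lia|]. intros _. replace (S n - 1)%nat with n by lia.
  rewrite !Tnum_walks, !Mnum_walks, ell_walks. unfold motzkin_walks.
  simpl (0 + 2)%Z. lia.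
Qed.

Lemma ell_trin n : (3 <= n)%nat ->
  ell n = (trin n (n - 2) + trin (n - 1) (n - 3))%nat.
Proof.
  intro Hn. apply Nat2Z.inj. rewrite Nat2Z.inj_add.
  replace (n - 3)%nat with (n - 1 - 2)%nat by lia.
  (* The second rewriting needs [2 <= n - 1], whence the bound 3. *)
  rewrite !trin_sub_walks by lia.
  destruct n as [|n]; [lia|]. rewrite ell_walks.
  now replace (S n - 1)%nat with n by lia.
Qed.

(** * Formal power series *)

Definition fps_tail (f : fps) : fps := fun k => f (S k).
Definition fps_add (f g : fps) : fps := fun k => (f k + g k)%Z.
Definition fps_opp (f : fps) : fps := fun k => (- f k)%Z.
Definition fps_0 : fps := fun _ => 0%Z.
Definition fps_1 : fps := fps_poly [1%Z].
Definition fps_X : fps := fps_poly [0%Z; 1%Z].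

Lemma fold_left_Zadd {A} (F : A -> Z) l x :
  fold_left (fun acc i => (acc + F i)%Z) l x
  = (x + fold_left (fun acc i => (acc + F i)%Z) l 0)%Z.
Proof.
  revert x. induction l as [|a l IH]; intro x; cbn [fold_left]; [lia|].
  rewrite IH, (IH (0 + F a)%Z). lia.
Qed.

Lemma fold_left_map {A B C} (F : A -> B -> A) (u : C -> B) l x :
  fold_left F (map u l) x = fold_left (fun acc i => F acc (u i)) l x.
Proof.
  revert x. induction l as [|a l IH]; intro x; [reflexivity|]. apply IH.
Qed.

Lemma fps_mul_0 f g : fps_mul f g 0 = (f 0%nat * g 0%nat)%Z.
Proof. unfold fps_mul. cbn -[Z.add Z.mul]. lia. Qed.

(** Turns the convolution into a recursion on the coefficient index, on which the ring laws of the
    product rest. *)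
Lemma fps_mul_S f g k :
  fps_mul f g (S k) = (f 0%nat * g (S k) + fps_mul (fps_tail f) g k)%Z.
Proof.
  unfold fps_mul. change (seq 0 (S (S k))) with (0%nat :: seq 1 (S k)).
  rewrite <- seq_shift. cbn [fold_left].
  rewrite fold_left_map, fold_left_Zadd. reflexivity.
Qed.

Lemma fps_mul_S_r f g k :
  fps_mul f g (S k) = (f (S k) * g 0%nat + fps_mul f (fps_tail g) k)%Z.
Proof.
  revert f. induction k as [|k IH]; intro f.
  - rewrite fps_mul_S, !fps_mul_0. unfold fps_tail. lia.
  - rewrite fps_mul_S, IH, (fps_mul_S f). unfold fps_tail. lia.
Qed.

Lemma fps_mulC f g : fps_mul f g = fps_mul g f.
Proof.
  apply functional_extensionality. intro k. revert f.
  induction k as [|k IH]; intro f.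
  - rewrite !fps_mul_0. lia.
  - rewrite fps_mul_S, fps_mul_S_r, IH. lia.
Qed.

Lemma fps_mulDl f g h :
  fps_mul (fps_add f g) h = fps_add (fps_mul f h) (fps_mul g h).
Proof.
  apply functional_extensionality. intro k. revert f g. unfold fps_add.
  induction k as [|k IH]; intros f g.
  - rewrite !fps_mul_0. lia.
  - rewrite !fps_mul_S. unfold fps_tail in *. rewrite IH. lia.
Qed.

Lemma fps_mul_scale c f g k :
  fps_mul (fun i => (c * f i)%Z) g k = (c * fps_mul f g k)%Z.
Proof.
  revert f. induction k as [|k IH]; intros f.
  - rewrite !fps_mul_0. lia.
  - rewrite !fps_mul_S. unfold fps_tail in *. rewrite IH. lia.
Qed.

Lemma fps_mulA f g h : fps_mul f (fps_mul g h) = fps_mul (fps_mul f g) h.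
Proof.
  apply functional_extensionality. intro k. revert f.
  induction k as [|k IH]; intro f.
  - rewrite !fps_mul_0. lia.
  - rewrite (fps_mul_S f), (fps_mul_S (fps_mul f g)), IH, fps_mul_0.
    replace (fps_tail (fps_mul f g))
      with (fps_add (fun i => (f 0%nat * fps_tail g i)%Z) (fps_mul (fps_tail f) g)).
    + rewrite fps_mulDl, (fps_mul_S g). unfold fps_add. rewrite fps_mul_scale. lia.
    + apply functional_extensionality. intro i.
      unfold fps_tail at 3. now rewrite fps_mul_S.
Qed.

Lemma fps_mul0 f k : fps_mul fps_0 f k = 0%Z.
Proof.
  induction k as [|k IH]; [apply fps_mul_0|].
  rewrite fps_mul_S. change (fps_tail fps_0) with fps_0. rewrite IH. reflexivity.
Qed.

Lemma fps_tail_1 : fps_tail fps_1 = fps_0.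
Proof. apply functional_extensionality. intros [|k]; reflexivity. Qed.

Lemma fps_mul1 f : fps_mul fps_1 f = f.
Proof.
  apply functional_extensionality. intros [|k].
  - rewrite fps_mul_0. cbn -[Z.mul]. lia.
  - rewrite fps_mul_S, fps_tail_1, fps_mul0. cbn -[Z.mul]. lia.
Qed.

Lemma fps_mulX_0 f : fps_mul fps_X f 0 = 0%Z.
Proof. now rewrite fps_mul_0. Qed.

Lemma fps_mulX_S f k : fps_mul fps_X f (S k) = f k.
Proof. rewrite fps_mul_S. change (fps_tail fps_X) with fps_1. now rewrite fps_mul1. Qed.

(** Functional extensionality gives the laws for Leibniz equality, so that [ring] can manipulate
    whole series. *)
Lemma fps_ring :
  ring_theory fps_0 fps_1 fps_add fps_mul fps_sub fps_opp (@eq fps).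
Proof.
  constructor; intros.
  1-3, 8-9: apply functional_extensionality; intro k;
    unfold fps_add, fps_0, fps_sub, fps_opp; lia.
  - apply fps_mul1.
  - apply fps_mulC.
  - apply fps_mulA.
  - apply fps_mulDl.
Qed.

Add Ring fps_ring_inst : fps_ring.

(** This lemma and the next three expand literal polynomials in [fps_1] and [fps_X], since [ring]
    treats [fps_poly] as opaque. *)
Lemma fps_poly_0 : fps_poly [0%Z] = fps_0.
Proof. apply functional_extensionality. intros [|[|k]]; reflexivity. Qed.

Lemma fps_poly_cons a b l :
  fps_poly (a :: b :: l) = fps_add (fps_poly [a]) (fps_mul fps_X (fps_poly (b :: l))).
Proof.
  apply functional_extensionality. intro k. unfold fps_add. destruct k as [|k].
  - rewrite fps_mulX_0. cbn. lia.
  - rewrite fps_mulX_S. destruct k; reflexivity.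
Qed.

Lemma fps_poly_pos p :
  fps_poly [Z.pos (Pos.succ p)] = fps_add fps_1 (fps_poly [Z.pos p]).
Proof.
  apply functional_extensionality. unfold fps_add, fps_1, fps_poly.
  intros [|[|k]]; cbn [nth]; lia.
Qed.

Lemma fps_poly_neg p : fps_poly [Z.neg p] = fps_opp (fps_poly [Z.pos p]).
Proof. apply functional_extensionality. unfold fps_opp. intros [|[|k]]; reflexivity. Qed.

(* Decomposition of a walk from [g + h + 1] at its first visit to [h]. *)
Lemma first_passage h n : (0 <= h)%Z -> forall g, (0 <= g)%Z ->
  fps_mul (fun i => motzkin_walks i g) (fun i => walks i h) n
  = walks (S n) (g + h + 1).
Proof.
  intro Hh. induction n as [|n IH]; intros g Hg.
  - rewrite fps_mul_0. unfold motzkin_walks. cbn [walks].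
    destruct (Z.eqb_spec g 0), (Z.eqb_spec (g + 2) 0), (Z.eqb_spec h 0),
      (Z.eqb_spec (g + h + 1 + 1) 0), (Z.eqb_spec (g + h + 1) 0),
      (Z.eqb_spec (g + h + 1 - 1) 0); lia.
  - rewrite fps_mul_S.
    replace (fps_tail (fun i => motzkin_walks i g))
      with (fps_add (fps_add (fun i => motzkin_walks i (g + 1))
                             (fun i => motzkin_walks i g))
                    (fun i => motzkin_walks i (g - 1))).
    2: { apply functional_extensionality. intro i. unfold fps_tail, fps_add.
         now rewrite motzkin_walks_S. }
    rewrite !fps_mulDl. unfold fps_add. rewrite !IH by lia.
    rewrite (walks_S (S n) (g + h + 1)).
    replace (g + 1 + h + 1)%Z with (g + h + 1 + 1)%Z by lia.
    (* For [g = 0] the term at height -1 vanishes; the walks stepping at once to [h] come from the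
       constant coefficient instead. *)
    destruct (Z.eq_dec g 0) as [->|N].
    + replace (fun i => motzkin_walks i (0 - 1)) with fps_0
        by (apply functional_extensionality; intro; symmetry; apply motzkin_walks_m1).
      rewrite fps_mul0. replace (0 + h + 1 - 1)%Z with h by lia.
      change (motzkin_walks 0 0) with 1%Z. lia.
    + rewrite IH by lia. replace (g + h + 1 - 1)%Z with (g - 1 + h + 1)%Z by lia.
      replace (motzkin_walks 0 g) with 0%Z; [lia|].
      unfold motzkin_walks. cbn [walks].
      destruct (Z.eqb_spec g 0), (Z.eqb_spec (g + 2) 0); lia.
Qed.

(** * First-passage equations and the edge generating series *)

Definition motzkin_series : fps := fun n => motzkin_walks n 0.
Definition central_series : fps := fun n => walks n 0.

(** The factor 2 comes from the symmetric first steps up and down; [first_passage] counts the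
    returns from height 1. *)
Lemma central_series_eq :
  fps_mul (fps_mul fps_X fps_X)
    (fps_mul (fps_add fps_1 fps_1) (fps_mul motzkin_series central_series))
  = fps_sub (fps_sub central_series fps_1) (fps_mul fps_X central_series).
Proof.
  rewrite <- fps_mulA. apply functional_extensionality. intros [|[|k]];
    unfold fps_sub; rewrite ?fps_mulX_0, ?fps_mulX_S.
  - reflexivity.
  - rewrite fps_mulX_0. reflexivity.
  - rewrite fps_mulDl, !fps_mul1. unfold fps_add, motzkin_series, central_series.
    rewrite first_passage by lia. simpl (0 + _)%Z.
    rewrite (walks_S (S k)). assert (O := walks_opp (S k) 1).
    replace (fps_1 (S (S k))) with 0%Z by (destruct k; reflexivity).
    simpl (- (1))%Z in O. simpl (0 + 1)%Z. simpl (0 - 1)%Z. lia.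
Qed.

(** Splitting the second factor by reflection makes [first_passage] applicable; the result
    [motzkin_walks (S k) 1] counts what follows an initial [U]. *)
Lemma motzkin_series_eq :
  fps_mul (fps_mul fps_X fps_X) (fps_mul motzkin_series motzkin_series)
  = fps_sub (fps_sub motzkin_series fps_1) (fps_mul fps_X motzkin_series).
Proof.
  rewrite <- fps_mulA. apply functional_extensionality. intros [|[|k]];
    unfold fps_sub; rewrite ?fps_mulX_0, ?fps_mulX_S.
  - reflexivity.
  - rewrite fps_mulX_0. reflexivity.
  - replace (fps_1 (S (S k))) with 0%Z by (destruct k; reflexivity).
    replace (fps_mul motzkin_series motzkin_series)
      with (fps_sub (fps_mul motzkin_series (fun i => walks i 0))
                    (fps_mul motzkin_series (fun i => walks i 2))).
    2: { replace motzkin_series with (fps_sub (fun i => walks i 0) (fun i => walks i 2))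
           by reflexivity. ring. }
    unfold fps_sub, motzkin_series. rewrite !first_passage by lia.
    rewrite motzkin_walks_S by lia. change (0 - 1)%Z with (-1)%Z.
    rewrite motzkin_walks_m1. unfold motzkin_walks. simpl (0 + _)%Z.
    simpl (_ + 1)%Z. simpl (1 + _)%Z. lia.
Qed.

(** The difference on the right has coefficients [walks n 2], so this is [ell_walks]; the constant
    terms cancel, as a one-point lattice has no edge. *)
Lemma ell_series_eq :
  ell_series = fps_mul (fps_add fps_1 fps_X) (fps_sub central_series motzkin_series).
Proof.
  apply functional_extensionality. intro n.
  rewrite fps_mulDl, fps_mul1. unfold fps_add, ell_series. destruct n as [|n].
  - rewrite fps_mulX_0. reflexivity.
  - rewrite fps_mulX_S, ell_walks. unfold fps_sub, central_series, motzkin_series, motzkin_walks.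
    simpl (0 + _)%Z. lia.
Qed.

Lemma ell_generating_series :
  exists s : fps,
    s 0%nat = 1%Z /\
    (forall k, fps_mul s s k = fps_poly [1%Z; (-2)%Z; (-3)%Z] k) /\
    (forall k,
       fps_mul (fps_mul (fps_poly [0%Z; 0%Z; 2%Z]) s) ell_series k =
       fps_mul (fps_poly [1%Z; 1%Z])
               (fps_sub (fps_poly [1%Z; (-2)%Z; (-1)%Z])
                        (fps_mul (fps_poly [1%Z; (-1)%Z]) s)) k).
Proof.
  set (X := fps_X). set (M := motzkin_series). set (T := central_series).
  (* Completing the square in the quadratic equation for [M] gives this root of the discriminant. *)
  set (s := fps_sub (fps_sub fps_1 X)
              (fps_mul (fps_mul X X) (fps_mul (fps_add fps_1 fps_1) M))).
  assert (Q := motzkin_series_eq). assert (P := central_series_eq).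
  fold M T X in P, Q.
  assert (Es : fps_mul s s = fps_poly [1%Z; (-2)%Z; (-3)%Z]).
  { assert (E : fps_mul s s =
       fps_add (fps_sub (fps_mul (fps_sub fps_1 X) (fps_sub fps_1 X))
         (fps_mul (fps_mul (fps_mul (fps_add fps_1 fps_1) (fps_add fps_1 fps_1))
                   (fps_mul X X)) (fps_mul (fps_sub fps_1 X) M)))
         (fps_mul (fps_mul (fps_mul (fps_add fps_1 fps_1) (fps_add fps_1 fps_1))
                   (fps_mul X X))
            (fps_mul (fps_mul X X) (fps_mul M M)))) by (unfold s; ring).
    rewrite E, Q, !fps_poly_cons, !fps_poly_neg.
    change 3%positive with (Pos.succ (Pos.succ 1)).
    change 2%positive with (Pos.succ 1).
    rewrite !fps_poly_pos. fold fps_1 X. ring. }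
  assert (Est : fps_mul s T = fps_1).
  { assert (E : fps_mul s T =
       fps_sub (fps_mul (fps_sub fps_1 X) T)
         (fps_mul (fps_mul X X) (fps_mul (fps_add fps_1 fps_1) (fps_mul M T))))
      by (unfold s; ring).
    rewrite E, P. ring. }
  assert (EM : fps_mul (fps_mul X X) (fps_mul (fps_add fps_1 fps_1) M)
               = fps_sub (fps_sub fps_1 X) s) by (unfold s; ring).
  exists s. split; [|split; intro k].
  - unfold s, fps_sub. rewrite <- fps_mulA. unfold X. rewrite !fps_mulX_0. reflexivity.
  - now rewrite Es.
  - apply (f_equal (fun f : fps => f k)). rewrite ell_series_eq. fold T M X.
    assert (E2 : fps_poly [2%Z] = fps_add fps_1 fps_1)
      by exact (fps_poly_pos 1).
    assert (E3 : fps_poly [3%Z] = fps_add fps_1 (fps_add fps_1 fps_1))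
      by (rewrite <- E2; exact (fps_poly_pos 2)).
    repeat rewrite fps_poly_cons. repeat rewrite fps_poly_cons in Es.
    rewrite fps_poly_0, !fps_poly_neg, E2. rewrite !fps_poly_neg, E2, E3 in Es.
    fold fps_1 X. fold fps_1 X in Es.
    (* With [s] opaque, the left side is regrouped to expose [s T] and [2 X^2 M], which [Est] and
       [EM] eliminate. *)
    clearbody s.
    transitivity (fps_mul (fps_add fps_1 X)
       (fps_sub (fps_mul (fps_mul (fps_add fps_1 fps_1) (fps_mul X X)) (fps_mul s T))
                (fps_mul s (fps_mul (fps_mul X X) (fps_mul (fps_add fps_1 fps_1) M)))));
      [ring|].
    rewrite Est, EM.
    replace (fps_mul s (fps_sub (fps_sub fps_1 X) s))
      with (fps_sub (fps_mul (fps_sub fps_1 X) s) (fps_mul s s)) by ring.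
    rewrite Es. ring.
Qed.

(** * Binomial sums *)

Local Open Scope R_scope.

Definition binsum (n : nat) (f : nat -> R) : R :=
  sum_f_R0 (fun m => Binomial.C n m * f m) n.

Lemma binsum_ext n f g : (forall m, (m <= n)%nat -> f m = g m) -> binsum n f = binsum n g.
Proof. intro E. apply sum_eq. intros i Hi. now rewrite E. Qed.

Lemma binsum_add n f g : binsum n (fun m => f m + g m) = binsum n f + binsum n g.
Proof.
  unfold binsum. rewrite <- plus_sum. apply sum_eq. intros. ring.
Qed.

Lemma binsum_scal n c f : binsum n (fun m => c * f m) = c * binsum n f.
Proof.
  unfold binsum. rewrite scal_sum. apply sum_eq. intros. ring.
Qed.

Lemma C_0 n : Binomial.C n 0 = 1.
Proof. unfold Binomial.C. rewrite Nat.sub_0_r. simpl. field. apply INR_fact_neq_0. Qed.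

Lemma C_diag n : Binomial.C n n = 1.
Proof. unfold Binomial.C. rewrite Nat.sub_diag. simpl. field. apply INR_fact_neq_0. Qed.

Lemma C_ge0 n m : 0 <= Binomial.C n m.
Proof.
  unfold Binomial.C. apply Rlt_le, Rdiv_lt_0_compat;
    try apply Rmult_lt_0_compat; apply INR_fact_lt_0.
Qed.

Lemma binsum_le n f g : (forall m, (m <= n)%nat -> f m <= g m) -> binsum n f <= binsum n g.
Proof.
  intro E. apply sum_Rle. intros i Hi.
  apply Rmult_le_compat_l; [apply C_ge0|auto].
Qed.

Lemma binsum_0 f : binsum 0 f = f 0%nat.
Proof. unfold binsum. simpl. rewrite C_0. ring. Qed.

(** Pascal's rule in summed form; it allows binomial sums to be evaluated by induction on [n]. *)
Lemma binsum_S n f : binsum (S n) f = binsum n (fun m => f m + f (S m)).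
Proof.
  rewrite binsum_add. unfold binsum.
  destruct n as [|n].
  - simpl. rewrite (C_diag 1), !C_0. ring.
  - rewrite (decomp_sum (fun m => Binomial.C (S (S n)) m * f m)) by lia.
    rewrite (decomp_sum (fun m => Binomial.C (S n) m * f m)) by lia.
    cbn [pred]. rewrite (tech5 _ n), (tech5 (fun m => Binomial.C (S n) m * f (S m))).
    rewrite !C_0, !C_diag.
    rewrite (sum_eq (fun i => Binomial.C (S (S n)) (S i) * f (S i))
                    (fun i => Binomial.C (S n) (S i) * f (S i) + Binomial.C (S n) i * f (S i))).
    + rewrite plus_sum. ring.
    + intros i Hi. rewrite <- pascal by lia. ring.
Qed.

(** * Walks with steps 1 and -1 *)

Fixpoint updown (n : nat) (j : Z) : Z :=
  match n with
  | O => if Z.eqb j 0 then 1 else 0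
  | S m => updown m (j + 1) + updown m (j - 1)
  end%Z.

(* Choose which of the steps are not horizontal. *)
Lemma walks_binsum n : forall j, IZR (walks n j) = binsum n (fun m => IZR (updown m j)).
Proof.
  induction n as [|n IH]; intro j.
  - rewrite binsum_0. reflexivity.
  - rewrite walks_S, binsum_S, !plus_IZR, !IH, <- !binsum_add.
    apply binsum_ext. intros m _. cbn [updown]. rewrite plus_IZR. ring.
Qed.

Lemma updown_odd n : forall j, Z.odd (Z.of_nat n + j) = true -> updown n j = 0%Z.
Proof.
  induction n as [|n IH]; intros j Hj.
  - simpl in *. destruct (Z.eqb_spec j 0) as [->|]; [discriminate|reflexivity].
  - cbn [updown]. rewrite !IH; trivial.
    + replace (Z.of_nat n + (j - 1))%Z with (Z.of_nat (S n) + j + 2 * (-1))%Z by lia.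
      now rewrite Z.odd_add_mul_2.
    + now replace (Z.of_nat n + (j + 1))%Z with (Z.of_nat (S n) + j)%Z by lia.
Qed.

Lemma updown_out n : forall j, (Z.of_nat n < Z.abs j)%Z -> updown n j = 0%Z.
Proof.
  induction n as [|n IH]; intros j Hj.
  - simpl. destruct (Z.eqb_spec j 0); lia.
  - cbn [updown]. rewrite !IH; lia.
Qed.

(** [i] and [k] count the steps of either sign; a walk is a choice of their positions. *)
Lemma updown_C n : forall i k, n = (i + k)%nat ->
  IZR (updown n (Z.of_nat i - Z.of_nat k)) = Binomial.C n i.
Proof.
  induction n as [|n IH]; intros i k E.
  - replace i with 0%nat by lia. replace k with 0%nat by lia. rewrite C_0. reflexivity.
  - cbn [updown]. rewrite plus_IZR.
    destruct i as [|i].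
    + rewrite (updown_out n (Z.of_nat 0 - Z.of_nat k - 1)) by lia.
      replace (Z.of_nat 0 - Z.of_nat k + 1)%Z
        with (Z.of_nat 0 - Z.of_nat (pred k))%Z by lia.
      rewrite IH, !C_0 by lia. ring.
    + replace (Z.of_nat (S i) - Z.of_nat k - 1)%Z
        with (Z.of_nat i - Z.of_nat k)%Z by lia.
      rewrite (IH i k) by lia.
      destruct k as [|k].
      * rewrite updown_out by lia.
        replace i with n by lia. rewrite !C_diag. ring.
      * replace (Z.of_nat (S i) - Z.of_nat (S k) + 1)%Z
          with (Z.of_nat (S i) - Z.of_nat k)%Z by lia.
        rewrite (IH (S i) k) by lia. rewrite <- pascal by lia. ring.
Qed.

Lemma updown_even_0 k : IZR (updown (2 * k) 0) = Binomial.C (2 * k) k.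
Proof.
  rewrite <- (updown_C (2 * k) k k) by lia. do 2 f_equal. lia.
Qed.

Lemma updown_even_2 k :
  IZR (updown (2 * k) 2) = Binomial.C (2 * k) k * (INR k / (INR k + 1)).
Proof.
  destruct k as [|k].
  - simpl. lra.
  - replace 2%Z with (Z.of_nat (S (S k)) - Z.of_nat k)%Z by lia.
    rewrite updown_C by lia. unfold Binomial.C.
    replace (2 * S k - S (S k))%nat with k by lia.
    replace (2 * S k - S k)%nat with (S k) by lia.
    rewrite (fact_simpl (S k)), (fact_simpl k), !mult_INR, !S_INR.
    assert (A := pos_INR k). assert (B := INR_fact_neq_0 k). field.
    repeat split; trivial; lra.
Qed.

Lemma sum_even (g : nat -> R) n : (forall k, g (2 * k + 1)%nat = 0) ->
  sum_f_R0 g n = sum_f_R0 (fun k => g (2 * k)%nat) (n / 2).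
Proof.
  intro Hg.
  assert (E : forall p, sum_f_R0 g (2 * p) = sum_f_R0 (fun k => g (2 * k)%nat) p).
  { induction p as [|p IH]; [reflexivity|].
    replace (2 * S p)%nat with (S (S (2 * p))) by lia.
    rewrite !tech5, IH. replace (S (2 * p)) with (2 * p + 1)%nat by lia.
    rewrite Hg. replace (S (2 * p + 1)) with (2 * S p)%nat by lia. ring. }
  assert (D := Nat.div_mod_eq n 2). assert (M := Nat.mod_upper_bound n 2 ltac:(lia)).
  destruct (n mod 2) as [|[|]] eqn:Q; [| |lia].
  - rewrite <- E. f_equal. lia.
  - generalize dependent (n / 2)%nat. intros p D.
    replace n with (S (2 * p)) by lia.
    rewrite tech5, E. replace (S (2 * p)) with (2 * p + 1)%nat by lia.
    rewrite Hg. ring.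
Qed.

Lemma C_C n k : (2 * k <= n)%nat ->
  Binomial.C n (2 * k) * Binomial.C (2 * k) k = Binomial.C n k * Binomial.C (n - k) k.
Proof.
  intro Hk. unfold Binomial.C.
  replace (2 * k - k)%nat with k by lia.
  replace (n - k - k)%nat with (n - 2 * k)%nat by lia.
  field. repeat split; apply INR_fact_neq_0.
Qed.

Lemma walks_2_sum n :
  IZR (walks n 2)
  = sum_f_R0 (fun k => Binomial.C n k * Binomial.C (n - k) k * (INR k / (INR k + 1))) (n / 2).
Proof.
  rewrite walks_binsum. unfold binsum. rewrite sum_even.
  - apply sum_eq. intros k Hk. assert (D := Nat.div_mod_eq n 2).
    rewrite updown_even_2, <- C_C by lia. ring.
  - intro k. rewrite updown_odd; [ring|].
    replace (Z.of_nat (2 * k + 1) + 2)%Z with (1 + 2 * (Z.of_nat k + 1))%Z by lia.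
    now rewrite Z.odd_add_mul_2.
Qed.

(** Brings the sums for [walks n 2] and [walks (S n) 2] to a common summand. *)
Lemma C_C_pred n k : (2 * k <= n)%nat ->
  Binomial.C n k * Binomial.C (n - k) k
  = Binomial.C (S n) k * Binomial.C (S n - k) k * ((INR (S n) - 2 * INR k) / INR (S n)).
Proof.
  intro Hk. unfold Binomial.C.
  replace (S n - k)%nat with (S (n - k)) by lia.
  replace (S (n - k) - k)%nat with (S (n - 2 * k)) by lia.
  replace (n - k - k)%nat with (n - 2 * k)%nat by lia.
  rewrite !fact_simpl, !mult_INR, !S_INR, !minus_INR, mult_INR by lia.
  change (INR 2) with 2.
  assert (A := pos_INR n). assert (B := pos_INR k). apply le_INR in Hk as Hk'.
  rewrite mult_INR in Hk'. change (INR 2) with 2 in Hk'.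
  field. repeat split; try apply INR_fact_neq_0; lra.
Qed.

Lemma ell_binomial_sum n : (1 <= n)%nat ->
  INR (ell n) =
  2 / INR n *
  sum_f_R0 (fun k => Binomial.C n k * Binomial.C (n - k) k
                     * INR (k * (n - k)) / INR (k + 1)) (n / 2).
Proof.
  destruct n as [|n]; [lia|]. intros _.
  rewrite INR_IZR_INZ, ell_walks, plus_IZR, !walks_2_sum.
  set (c := fun k => Binomial.C (S n) k * Binomial.C (S n - k) k * (INR k / (INR k + 1))).
  assert (N : INR (S n) <> 0) by (apply not_0_INR; lia).
  assert (E : sum_f_R0 (fun k => Binomial.C n k * Binomial.C (n - k) k
                                 * (INR k / (INR k + 1))) (n / 2)
              = sum_f_R0 (fun k => c k * ((INR (S n) - 2 * INR k) / INR (S n))) (S n / 2)).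
  { transitivity (sum_f_R0 (fun k => c k * ((INR (S n) - 2 * INR k) / INR (S n))) (n / 2)).
    - apply sum_eq. intros k Hk. assert (D := Nat.div_mod_eq n 2).
      rewrite C_C_pred by lia. unfold c. ring.
    - assert (D := Nat.div_mod_eq n 2). assert (M := Nat.mod_upper_bound n 2 ltac:(lia)).
      assert (D' := Nat.div_mod_eq (S n) 2).
      assert (M' := Nat.mod_upper_bound (S n) 2 ltac:(lia)).
      (* The upper limits differ only if [S n = 2 * S (n / 2)], and then the additional summand
         carries the factor [S n - 2 k = 0]. *)
      assert (Q : (S n / 2 = n / 2 \/ (S n / 2 = S (n / 2) /\ S n = 2 * S (n / 2)))%nat) by lia.
      destruct Q as [->|[-> Q]]; [reflexivity|].
      apply (f_equal INR) in Q. rewrite mult_INR in Q. change (INR 2) with 2 in Q.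
      rewrite tech5. replace (INR (S n) - 2 * INR (S (n / 2))) with 0 by lra.
      field. exact N. }
  (* The summands combine through 1 + (N - 2 k) / N = 2 (N - k) / N, where N is [INR (S n)]. *)
  rewrite E, <- plus_sum, scal_sum. apply sum_eq. intros k Hk.
  assert (D := Nat.div_mod_eq (S n) 2).
  unfold c. rewrite mult_INR, plus_INR, minus_INR by lia. change (INR 1) with 1.
  assert (A := pos_INR k). field. repeat split; trivial; lra.
Qed.

(** * Wallis' inequalities *)

Definition wallis (n : nat) : R := RInt (fun x => sin x ^ n) 0 (PI / 2).

Lemma ex_RInt_sin_pow n : ex_RInt (fun x => sin x ^ n) 0 (PI / 2).
Proof.
  apply (ex_RInt_continuous (V := R_CompleteNormedModule)). intros x _.
  apply (ex_derive_continuous (K := R_AbsRing) (V := R_NormedModule)).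
  auto_derive. trivial.
Qed.

Lemma wallis_0 : wallis 0 = PI / 2.
Proof.
  unfold wallis. rewrite (RInt_ext _ (fun _ => 1)) by (intros; reflexivity).
  rewrite RInt_const. unfold scal. simpl. unfold mult. simpl. ring.
Qed.

Lemma wallis_1 : wallis 1 = 1.
Proof.
  apply is_RInt_unique.
  replace 1 with (minus (- cos (PI / 2)) (- cos 0))
    by (rewrite cos_PI2, cos_0; unfold minus, plus, opp; simpl; ring).
  apply (is_RInt_derive (fun x => - cos x)).
  - intros x _. auto_derive; trivial. ring.
  - intros x _. apply (ex_derive_continuous (K := R_AbsRing) (V := R_NormedModule)).
    auto_derive. trivial.
Qed.

(* Integrate the derivative of [cos * sin ^ (n + 1)]. *)
Lemma wallis_SS n : (INR n + 2) * wallis (S (S n)) = (INR n + 1) * wallis n.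
Proof.
  assert (E : is_RInt (fun x => (INR n + 1) * sin x ^ n - (INR n + 2) * sin x ^ S (S n))
                0 (PI / 2) ((INR n + 1) * wallis n - (INR n + 2) * wallis (S (S n)))).
  { apply (is_RInt_minus (V := R_NormedModule));
      apply (is_RInt_scal (V := R_NormedModule));
      apply (RInt_correct (V := R_CompleteNormedModule)), ex_RInt_sin_pow. }
  assert (F : is_RInt (fun x => (INR n + 1) * sin x ^ n - (INR n + 2) * sin x ^ S (S n))
                0 (PI / 2) (minus (cos (PI / 2) * sin (PI / 2) ^ S n) (cos 0 * sin 0 ^ S n))).
  { apply (is_RInt_derive (fun x => cos x * sin x ^ S n)).
    - intros x _. auto_derive; trivial.
      replace (match n with 0%nat => 1 | S _ => INR n + 1 end) with (INR n + 1)
        by (destruct n; [simpl; ring|reflexivity]).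
      assert (T := sin2_cos2 x). unfold Rsqr in T.
      replace (Init.Nat.pred (S n)) with n by reflexivity.
      cbn [pow].
      transitivity (sin x ^ n * ((INR n + 1) * (cos x * cos x) - sin x * sin x)); [ring|].
      replace (cos x * cos x) with (1 - sin x * sin x) by lra. ring.
    - intros x _. apply (ex_derive_continuous (K := R_AbsRing) (V := R_NormedModule)).
      auto_derive. trivial. }
  apply (is_RInt_unique (V := R_CompleteNormedModule)) in E.
  apply (is_RInt_unique (V := R_CompleteNormedModule)) in F. rewrite E in F.
  rewrite cos_PI2, sin_0 in F. unfold minus, plus, opp in F. simpl in F.
  simpl pow. lra.
Qed.

Lemma wallis_decr n : wallis (S n) <= wallis n.
Proof.
  assert (P := PI_RGT_0). unfold wallis.
  apply RInt_le; try apply ex_RInt_sin_pow; [lra|].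
  intros x [H0 H1]. assert (A := sin_ge_0 x ltac:(lra) ltac:(lra)).
  assert (B := SIN_bound x). assert (Q := pow_le (sin x) n A).
  cbn [pow]. nra.
Qed.

Definition cbin (k : nat) : R := Binomial.C (2 * k) k / 4 ^ k.

Lemma cbin_0 : cbin 0 = 1.
Proof. unfold cbin. simpl. rewrite C_0. field. Qed.

Lemma cbin_S k : cbin (S k) = cbin k * ((2 * INR k + 1) / (2 * INR k + 2)).
Proof.
  unfold cbin, Binomial.C.
  replace (2 * S k - S k)%nat with (S k) by lia.
  replace (2 * k - k)%nat with k by lia.
  replace (2 * S k)%nat with (S (S (2 * k))) by lia.
  rewrite (fact_simpl (S (2 * k))), (fact_simpl (2 * k)), (fact_simpl k), !mult_INR,
    !S_INR, mult_INR. change (INR 2) with 2. cbn [pow].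
  assert (A := pos_INR k). assert (B := INR_fact_neq_0 k).
  assert (D : 4 ^ k <> 0) by (apply pow_nonzero; lra).
  field. repeat split; trivial; lra.
Qed.

Lemma cbin_pos k : 0 < cbin k.
Proof.
  induction k as [|k IH]; [rewrite cbin_0; lra|].
  rewrite cbin_S. assert (A := pos_INR k).
  apply Rmult_lt_0_compat; trivial. apply Rdiv_lt_0_compat; lra.
Qed.

(** The even integrals are proportional to [cbin] and the odd ones inversely related to it, so
    comparing consecutive integrals bounds the square of [cbin k]. *)
Lemma wallis_cbin k :
  wallis (2 * k) = PI / 2 * cbin k /\ wallis (2 * k + 1) * ((2 * INR k + 1) * cbin k) = 1.
Proof.
  induction k as [|k [IH1 IH2]].
  - simpl. rewrite wallis_0, wallis_1, cbin_0. lra.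
  - replace (2 * S k)%nat with (S (S (2 * k))) by lia.
    replace (S (S (2 * k)) + 1)%nat with (S (S (2 * k + 1))) by lia.
    assert (A := pos_INR k). assert (P := cbin_pos k).
    assert (E1 := wallis_SS (2 * k)). assert (E2 := wallis_SS (2 * k + 1)).
    rewrite plus_INR, mult_INR in E2. rewrite mult_INR, IH1 in E1.
    change (INR 2) with 2 in *. change (INR 1) with 1 in *.
    rewrite cbin_S, S_INR. split.
    + apply (Rmult_eq_reg_l (2 * INR k + 2)); [|lra]. rewrite E1. field. lra.
    + transitivity (wallis (2 * k + 1) * ((2 * INR k + 1) * cbin k)); [|exact IH2].
      replace (wallis (S (S (2 * k + 1))))
        with ((2 * INR k + 1 + 1) * wallis (2 * k + 1) / (2 * INR k + 1 + 2))
        by (rewrite <- E2; field; lra).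
      field. lra.
Qed.

(** From [wallis (2 * k + 1) <= wallis (2 * k)]. *)
Lemma cbin_sqr_ge k : 2 / (PI * (2 * INR k + 1)) <= cbin k * cbin k.
Proof.
  assert (P := PI_RGT_0). assert (B := cbin_pos k). assert (A := pos_INR k).
  destruct (wallis_cbin k) as [E1 E2].
  assert (D := wallis_decr (2 * k)). rewrite <- Nat.add_1_r in D. rewrite E1 in D.
  apply Rle_div_l; [nra|].
  assert (F : 1 <= PI / 2 * cbin k * ((2 * INR k + 1) * cbin k)); [|nra].
  rewrite <- E2 at 1. apply Rmult_le_compat_r; [nra|trivial].
Qed.

(** From [wallis (2 * k + 2) <= wallis (2 * k + 1)], with the index shifted by one; the product form
    covers [k = 0]. *)
Lemma cbin_sqr_le k : PI * INR k * (cbin k * cbin k) <= 1.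
Proof.
  destruct k as [|k]; [simpl; lra|].
  assert (P := PI_RGT_0). assert (B := cbin_pos k). assert (A := pos_INR k).
  assert (B' := cbin_pos (S k)).
  destruct (wallis_cbin k) as [_ E2]. destruct (wallis_cbin (S k)) as [E1 _].
  assert (D := wallis_decr (2 * k + 1)).
  replace (S (2 * k + 1)) with (2 * S k)%nat in D by lia. rewrite E1 in D.
  assert (F : PI / 2 * cbin (S k) * ((2 * INR k + 1) * cbin k) <= 1).
  { apply Rle_trans with (2 := Req_le _ _ E2). apply Rmult_le_compat_r; [nra|trivial]. }
  replace ((2 * INR k + 1) * cbin k) with (cbin (S k) * (2 * INR k + 2)) in F
    by (rewrite cbin_S; field; lra).
  rewrite S_INR. lra.
Qed.

(** * Asymptotics of the central trinomial coefficients *)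

Lemma binsum_pow x n : binsum n (fun m => x ^ m) = (1 + x) ^ n.
Proof.
  induction n as [|n IH]; [now rewrite binsum_0|].
  rewrite binsum_S, (binsum_ext n _ (fun m => (1 + x) * x ^ m)) by (intros; simpl; ring).
  rewrite (binsum_scal n (1 + x) (fun m => x ^ m)), IH. reflexivity.
Qed.

(** The binomial theorem under x d/dx, multiplied by [1 + x] to avoid the exponent [n - 1]. *)
Lemma binsum_INR_pow x n :
  (1 + x) * binsum n (fun m => INR m * x ^ m) = INR n * x * (1 + x) ^ n.
Proof.
  induction n as [|n IH]; [rewrite binsum_0; simpl; ring|].
  rewrite binsum_S, (binsum_ext n _ (fun m => (1 + x) * (INR m * x ^ m) + x * x ^ m))
    by (intros; rewrite S_INR; simpl; ring).
  rewrite binsum_add, (binsum_scal n x (fun m => x ^ m)), binsum_pow.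
  rewrite (binsum_scal n (1 + x) (fun m => INR m * x ^ m)), IH, S_INR. simpl. ring.
Qed.

(* Absorption: [(n + 1) C(n, m) = (m + 1) C(n + 1, m + 1)]. *)
Lemma binsum_absorb n f :
  INR (S n) * binsum n (fun m => f (S m) / INR (S m)) = binsum (S n) f - f 0%nat.
Proof.
  unfold binsum. rewrite (decomp_sum _ (S n)) by lia. rewrite C_0. cbn [pred].
  rewrite scal_sum.
  rewrite (sum_eq _ (fun m => Binomial.C (S n) (S m) * f (S m))); [ring|].
  intros m Hm. unfold Binomial.C.
  replace (S n - S m)%nat with (n - m)%nat by lia.
  rewrite !fact_simpl, !mult_INR. field.
  repeat split; try apply INR_fact_neq_0; apply not_0_INR; lia.
Qed.

(** The binomial theorem integrated from 0 to [x]; the next lemma integrates twice. *)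
Lemma binsum_pow_inv x n :
  binsum n (fun m => x ^ S m / INR (S m)) = ((1 + x) ^ S n - 1) / INR (S n).
Proof.
  assert (N : INR (S n) <> 0) by (apply not_0_INR; lia).
  apply (Rmult_eq_reg_l (INR (S n))); trivial.
  rewrite (binsum_absorb n (fun m => x ^ m)), binsum_pow, pow_O. field. trivial.
Qed.

Lemma binsum_pow_inv2 x n :
  binsum n (fun m => x ^ S (S m) / INR (S (S m)) / INR (S m))
  = (((1 + x) ^ S (S n) - 1) / INR (S (S n)) - x) / INR (S n).
Proof.
  assert (N : INR (S n) <> 0) by (apply not_0_INR; lia).
  apply (Rmult_eq_reg_l (INR (S n))); trivial.
  rewrite (binsum_absorb n (fun m => x ^ S m / INR (S m))), binsum_pow_inv.
  simpl (x ^ 1). change (INR 1) with 1. field. split; trivial. apply not_0_INR; lia.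
Qed.

(** This is [2 ^ m] restricted to even [m], written with both powers so that the closed forms at
    [x = 2] and [x = -2] apply. *)
Definition evenpow (m : nat) : R := (2 ^ m + (-2) ^ m) / 2.

Lemma pow_opp2_even k : (-2) ^ (2 * k) = 4 ^ k.
Proof. rewrite pow_mult. f_equal. ring. Qed.

Lemma evenpow_even k : evenpow (2 * k) = 4 ^ k.
Proof.
  unfold evenpow. rewrite pow_opp2_even, pow_mult.
  replace (2 ^ 2) with 4 by ring. field.
Qed.

Lemma evenpow_odd k : evenpow (2 * k + 1) = 0.
Proof.
  unfold evenpow. rewrite !pow_add, pow_opp2_even, pow_mult.
  replace (2 ^ 2) with 4 by ring. field.
Qed.

Lemma updown_cbin k : IZR (updown (2 * k) 0) = evenpow (2 * k) * cbin k.
Proof.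
  rewrite updown_even_0, evenpow_even. unfold cbin. field. apply pow_nonzero. lra.
Qed.

(** Reduces the bounds below to even [m]: walks of odd length do not return to 0, and [evenpow]
    vanishes there too. *)
Lemma updown_parity (P : nat -> R -> R -> Prop) :
  (forall k, P (2 * k)%nat (IZR (updown (2 * k) 0)) (evenpow (2 * k))) ->
  (forall k, P (2 * k + 1)%nat 0 0) -> forall m, P m (IZR (updown m 0)) (evenpow m).
Proof.
  intros E O m. destruct (Nat.Even_or_Odd m) as [[k ->]|[k ->]]; [apply E|].
  rewrite evenpow_odd, updown_odd; [apply O|].
  replace (Z.of_nat (2 * k + 1) + 0)%Z with (1 + 2 * Z.of_nat k)%Z by lia.
  now rewrite Z.odd_add_mul_2.
Qed.

(* AM-GM, [c <= (lam c^2 + 1 / lam) / 2]; the bound on [c^2] is chosen so that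
   its binomial sum has a closed form. *)
Lemma updown_le lam m : 0 < lam ->
  IZR (updown m 0) <=
  evenpow m * ((lam * (2 / PI) * (/ INR (S m) + 2 * (/ INR (S (S m)) / INR (S m)))
                + / lam) / 2).
Proof.
  intro Hl. revert m.
  apply (updown_parity (fun m z w => z <= w *
    ((lam * (2 / PI) * (/ INR (S m) + 2 * (/ INR (S (S m)) / INR (S m))) + / lam) / 2))).
  2: { intro k. rewrite Rmult_0_l. lra. }
  intro k. rewrite updown_cbin.
  assert (P := PI_RGT_0). assert (P4 := PI_4).
  assert (W : 0 <= evenpow (2 * k)) by (rewrite evenpow_even; apply pow_le; lra).
  apply Rmult_le_compat_l; trivial.
  assert (B := cbin_pos k). assert (Sq := cbin_sqr_le k).
  (* With m = 2k the parenthesis is (m + 4) / ((m + 1) (m + 2)), at least 1 / m once m >= 2; the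
     case [k = 0] uses PI <= 4. *)
  assert (Q : cbin k * cbin k <=
    2 / PI * (/ INR (S (2 * k)) + 2 * (/ INR (S (S (2 * k))) / INR (S (2 * k))))).
  { destruct (Nat.eq_dec k 0) as [->|N].
    - rewrite cbin_0. simpl.
      replace (2 / PI * (/ 1 + 2 * (/ (1 + 1) / 1))) with (4 / PI) by (field; lra).
      rewrite Rmult_1_r. apply Rle_div_r; lra.
    - assert (K : 1 <= INR k) by (apply (le_INR 1); lia).
      rewrite !S_INR, mult_INR. change (INR 2) with 2.
      apply Rle_trans with (/ (PI * INR k)).
      + apply (Rmult_le_reg_l (PI * INR k)); [nra|].
        rewrite Rinv_r by nra. exact Sq.
      + apply (Rmult_le_reg_l (PI * INR k)); [nra|].
        rewrite Rinv_r by nra.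
        replace (PI * INR k * (2 / PI * (/ (2 * INR k + 1) +
                 2 * (/ (2 * INR k + 1 + 1) / (2 * INR k + 1)))))
          with (2 * INR k * (2 * INR k + 4) / ((2 * INR k + 1) * (2 * INR k + 2)))
          by (field; lra).
        apply Rle_div_r; nra. }
  apply Rle_trans with ((lam * (cbin k * cbin k) + / lam) / 2).
  - apply Rmult_le_reg_r with (2 * lam); [lra|].
    replace ((lam * (cbin k * cbin k) + / lam) / 2 * (2 * lam))
      with ((lam * cbin k) * (lam * cbin k) + 1) by (field; lra).
    assert (D := Rle_0_sqr (lam * cbin k - 1)). unfold Rsqr in D. lra.
  - rewrite Rmult_assoc. apply Rmult_le_compat_r; [lra|].
    apply Rplus_le_compat_r, Rmult_le_compat_l; lra.
Qed.

(* [1 / sqrt u >= d (3 - u / y) / 2] with [d = 1 / sqrt y]: a convex function is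
   above its tangent at [y]. *)
Lemma updown_ge y d m : 0 < y -> 0 < d -> d * d * y * PI = 2 ->
  evenpow m * (d * (3 / 2 - (INR m + 1) / (2 * y))) <= IZR (updown m 0).
Proof.
  intros Hy Hd E. revert m.
  apply (updown_parity (fun m z w => w * (d * (3 / 2 - (INR m + 1) / (2 * y))) <= z)).
  2: { intro k. rewrite Rmult_0_l. lra. }
  intro k. rewrite updown_cbin.
  assert (P := PI_RGT_0).
  assert (W : 0 <= evenpow (2 * k)) by (rewrite evenpow_even; apply pow_le; lra).
  apply Rmult_le_compat_l; trivial.
  assert (B := cbin_pos k). assert (Sq := cbin_sqr_ge k).
  rewrite mult_INR. change (INR 2) with 2.
  assert (A := pos_INR k). set (u := 2 * INR k + 1) in *.
  assert (U : 0 < u) by (unfold u; lra).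
  assert (R : 0 < y / u) by (apply Rdiv_lt_0_compat; lra).
  set (s := sqrt (y / u)).
  assert (Hs : 0 < s) by (apply sqrt_lt_R0; trivial).
  assert (Es : s * s = y / u) by (apply sqrt_sqrt; lra).
  (* The condition on [d] makes [d * s] the square root of 2 / (PI u), which is the Wallis lower
     bound. *)
  assert (L : d * s <= cbin k).
  { apply Rsqr_incr_0; [|apply Rmult_le_pos; lra|lra]. unfold Rsqr.
    apply Rle_trans with (2 := Sq). right.
    replace (d * s * (d * s)) with (d * d * (s * s)) by ring. rewrite Es, <- E.
    field. lra. }
  apply Rle_trans with (2 := L). apply Rmult_le_compat_l; [lra|].
  replace (u / (2 * y)) with (/ (2 * (s * s))) by (rewrite Es; field; lra).
  apply (Rmult_le_reg_l (2 * (s * s))); [nra|].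
  replace (2 * (s * s) * (3 / 2 - / (2 * (s * s)))) with (3 * (s * s) - 1) by (field; lra).
  (* With denominators cleared, the tangent-line inequality reads 2 s^3 - 3 s^2 + 1 >= 0, which
     factors this way. *)
  assert (0 <= (s - 1) * (s - 1) * (2 * s + 1)); [|lra].
  apply Rmult_le_pos; [apply Rle_0_sqr|lra].
Qed.

(** * Bounds on the normalised central trinomial coefficients *)

Lemma pow_m1_bound n : -1 <= (-1) ^ n <= 1.
Proof. induction n as [|n IH]; simpl; lra. Qed.

Lemma pow3_ge n : INR n + 1 <= 3 ^ n.
Proof.
  induction n as [|n IH]; [simpl; lra|].
  assert (A := pos_INR n). rewrite S_INR. simpl. lra.
Qed.

(** Under the weights C(n, m) 2^m the mean of [m] is 2n/3, where C(m, m/2) / 2^m is about the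
    inverse of this scale; the even [m] carry about half of the total weight 3^n. *)
Definition trinomial_scale (n : nat) : R := sqrt (PI * INR n / 3).

Lemma trinomial_scale_sqr n :
  trinomial_scale n * trinomial_scale n = PI * INR n / 3.
Proof.
  apply sqrt_sqrt. assert (A := pos_INR n). assert (P := PI_RGT_0).
  apply Rmult_le_pos; nra.
Qed.

Lemma trinomial_scale_pos n : (1 <= n)%nat -> 0 < trinomial_scale n.
Proof.
  intro H. assert (A := lt_0_INR n ltac:(lia)). assert (P := PI_RGT_0).
  apply sqrt_lt_R0. apply Rmult_lt_0_compat; nra.
Qed.

Definition trinomial_ratio (n : nat) : R :=
  IZR (walks n 0) * (2 * trinomial_scale n) / 3 ^ n.

Lemma binsum_evenpow n : binsum n evenpow = (3 ^ n + (-1) ^ n) / 2.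
Proof.
  rewrite (binsum_ext n _ (fun m => / 2 * 2 ^ m + / 2 * (-2) ^ m))
    by (intros; unfold evenpow; field).
  rewrite binsum_add, !binsum_scal, !binsum_pow.
  replace (1 + 2) with 3 by ring. replace (1 + -2) with (-1) by ring. field.
Qed.

Lemma binsum_INR_evenpow n :
  binsum n (fun m => INR m * evenpow m) = INR n * (3 ^ n / 3 + (-1) ^ n).
Proof.
  rewrite (binsum_ext n _ (fun m => / 2 * (INR m * 2 ^ m) + / 2 * (INR m * (-2) ^ m)))
    by (intros; unfold evenpow; field).
  assert (A := binsum_INR_pow 2 n). assert (B := binsum_INR_pow (-2) n).
  rewrite binsum_add, !binsum_scal.
  replace (1 + 2) with 3 in A by ring. replace (1 + -2) with (-1) in B by ring.
  lra.
Qed.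

Lemma binsum_evenpow_inv n :
  binsum n (fun m => evenpow m / INR (S m)) = (3 * 3 ^ n + (-1) ^ n) / (4 * INR (S n)).
Proof.
  rewrite (binsum_ext n _ (fun m => / 4 * (2 ^ S m / INR (S m))
                                    + - / 4 * ((-2) ^ S m / INR (S m))))
    by (intros; unfold evenpow; simpl pow; field; apply not_0_INR; lia).
  rewrite binsum_add, !binsum_scal, !binsum_pow_inv.
  replace (1 + 2) with 3 by ring. replace (1 + -2) with (-1) by ring.
  simpl pow. field. apply not_0_INR; lia.
Qed.

Lemma binsum_evenpow_inv2 n :
  binsum n (fun m => evenpow m / INR (S (S m)) / INR (S m))
  = (9 * 3 ^ n + (-1) ^ n - 2) / (8 * INR (S n) * INR (S (S n))).
Proof.
  assert (N : forall k, INR (S k) <> 0) by (intro; apply not_0_INR; lia).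
  rewrite (binsum_ext n _ (fun m => / 8 * (2 ^ S (S m) / INR (S (S m)) / INR (S m))
                                    + / 8 * ((-2) ^ S (S m) / INR (S (S m)) / INR (S m))))
    by (intros; unfold evenpow; cbn [pow]; field; auto).
  rewrite binsum_add, !binsum_scal, !binsum_pow_inv2.
  replace (1 + 2) with 3 by ring. replace (1 + -2) with (-1) by ring.
  cbn [pow]. field. auto.
Qed.

Lemma trinomial_ratio_le n : (1 <= n)%nat -> trinomial_ratio n <= 1 + 3 / (INR n + 1).
Proof.
  intro Hn. assert (Hl := trinomial_scale_pos n Hn).
  assert (El := trinomial_scale_sqr n).
  unfold trinomial_ratio. set (lam := trinomial_scale n) in *.
  assert (P := PI_RGT_0). assert (N : 1 <= INR n) by (apply (le_INR 1); lia).
  assert (E := pow_m1_bound n). assert (Q := pow3_ge n).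
  (* Choosing [lam] as the scale balances the two AM-GM terms near the mean of [m]. *)
  assert (U : IZR (walks n 0) <=
    lam / PI * ((3 * 3 ^ n + (-1) ^ n) / (4 * INR (S n))
       + 2 * ((9 * 3 ^ n + (-1) ^ n - 2) / (8 * INR (S n) * INR (S (S n)))))
    + / lam / 2 * ((3 ^ n + (-1) ^ n) / 2)).
  { rewrite walks_binsum, <- binsum_evenpow, <- binsum_evenpow_inv, <- binsum_evenpow_inv2.
    rewrite <- !binsum_scal, <- binsum_add, <- binsum_scal, <- binsum_add.
    apply binsum_le. intros m _.
    apply Rle_trans with (1 := updown_le lam m Hl). right.
    field. repeat split; try apply not_0_INR; try lia; lra. }
  rewrite !S_INR in U.
  set (q := 3 ^ n) in *. set (e := (-1) ^ n) in *. set (x := INR n) in *.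
  clearbody q e x lam.
  assert (I : 0 < / (x + 1)) by (apply Rinv_0_lt_compat; lra).
  (* The sign term is at most 1, while [q >= x + 1]. *)
  assert (Eq : e <= q * / (x + 1)).
  { apply (Rle_div_r e q (x + 1)); nra. }
  apply Rle_div_l; [lra|].
  apply Rle_trans with (2 * lam * (lam / PI * ((3 * q + e) / (4 * (x + 1)) +
        2 * ((9 * q + e - 2) / (8 * (x + 1) * (x + 1 + 1)))) +
        / lam / 2 * ((q + e) / 2))); [nra|].
  replace (2 * lam * (lam / PI * ((3 * q + e) / (4 * (x + 1)) +
        2 * ((9 * q + e - 2) / (8 * (x + 1) * (x + 1 + 1)))) +
        / lam / 2 * ((q + e) / 2)))
    with (lam * lam * (2 / PI) * ((3 * q + e) / (4 * (x + 1)) +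
        (9 * q + e - 2) / (4 * (x + 1) * (x + 2))) + (q + e) / 2)
    by (field; lra).
  rewrite El.
  replace (PI * x / 3 * (2 / PI)) with (2 * x / 3) by (field; lra).
  apply Rle_trans with (2 * x / 3 * ((3 * q + q * / (x + 1)) / (4 * (x + 1)) +
        (9 * q) / (4 * (x + 1) * (x + 2))) + (q + q * / (x + 1)) / 2).
  - apply Rplus_le_compat; [|lra].
    apply Rmult_le_compat_l; [lra|].
    apply Rplus_le_compat; apply Rmult_le_compat_r; try lra;
      apply Rlt_le, Rinv_0_lt_compat; nra.
  - replace (2 * x / 3 * ((3 * q + q * / (x + 1)) / (4 * (x + 1)) +
        (9 * q) / (4 * (x + 1) * (x + 2))) + (q + q * / (x + 1)) / 2)
      with (q * (2 * x / 3 * ((3 * (x + 1) * (x + 2) + (x + 2) + 9 * (x + 1))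
              / (4 * (x + 1) * (x + 1) * (x + 2))) + (1 + / (x + 1)) / 2))
      by (field; lra).
    rewrite (Rmult_comm _ q). apply Rmult_le_compat_l; [lra|].
    apply Rminus_le_0.
    replace (1 + 3 / (x + 1) - (2 * x / 3 * ((3 * (x + 1) * (x + 2) + (x + 2) + 9 * (x + 1))
              / (4 * (x + 1) * (x + 1) * (x + 2))) + (1 + / (x + 1)) / 2))
      with ((6 * (x + 1) * (x + 1) * (x + 2) * (1 / 2) + 15 * (x + 1) * (x + 2)
             - x * (3 * (x + 1) * (x + 2) + (x + 2) + 9 * (x + 1)))
            / (6 * (x + 1) * (x + 1) * (x + 2))) by (field; lra).
    apply Rdiv_le_0_compat; nra.
Qed.

Lemma trinomial_ratio_ge n : (1 <= n)%nat -> 1 - 3 / INR n <= trinomial_ratio n.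
Proof.
  intro Hn. assert (Hl := trinomial_scale_pos n Hn).
  assert (El := trinomial_scale_sqr n).
  unfold trinomial_ratio. set (lam := trinomial_scale n) in *.
  assert (P := PI_RGT_0). assert (N : 1 <= INR n) by (apply (le_INR 1); lia).
  assert (E := pow_m1_bound n). assert (Q := pow3_ge n).
  (* The tangent point is the mean of [m] under the weights C(n, m) 2^m; then [d = / lam] meets the
     normalisation of [updown_ge]. *)
  set (y := 2 * INR n / 3).
  assert (L : / lam * (3 / 2 - / (2 * y)) * ((3 ^ n + (-1) ^ n) / 2)
     + - (/ lam * / (2 * y)) * (INR n * (3 ^ n / 3 + (-1) ^ n)) <= IZR (walks n 0)).
  { rewrite walks_binsum, <- binsum_evenpow, <- binsum_INR_evenpow.
    rewrite <- !binsum_scal, <- binsum_add.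
    apply binsum_le. intros m _.
    refine (Rle_trans _ _ _ _ (updown_ge y (/ lam) m _ _ _)).
    - right. field. unfold y. lra.
    - unfold y. lra.
    - now apply Rinv_0_lt_compat.
    - replace (/ lam * / lam * y * PI) with (y * PI / (lam * lam)) by (field; lra).
      rewrite El. unfold y. field. lra. }
  apply Rle_div_r; [lra|].
  apply Rle_trans with (2 * lam * (/ lam * (3 / 2 - / (2 * y)) * ((3 ^ n + (-1) ^ n) / 2)
     + - (/ lam * / (2 * y)) * (INR n * (3 ^ n / 3 + (-1) ^ n)))); [|nra].
  unfold y. set (q := 3 ^ n) in *. set (e := (-1) ^ n) in *. set (x := INR n) in *.
  replace (2 * lam * (/ lam * (3 / 2 - / (2 * (2 * x / 3))) * ((q + e) / 2)
     + - (/ lam * / (2 * (2 * x / 3))) * (x * (q / 3 + e))))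
    with (q - 3 / 4 * (q + e) * / x) by (field; lra).
  assert (I : 0 < / x) by (apply Rinv_0_lt_compat; lra).
  unfold Rdiv. nra.
Qed.

Lemma is_lim_seq_inv_S : is_lim_seq (fun n => / INR (S n)) 0.
Proof.
  apply (is_lim_seq_incr_1 (fun n => / INR n)).
  apply (is_lim_seq_inv INR p_infty); [apply is_lim_seq_INR|discriminate].
Qed.

Lemma is_lim_trinomial_ratio : is_lim_seq (fun n => trinomial_ratio (S n)) 1.
Proof.
  apply (is_lim_seq_le_le (fun n => 1 - 3 * / INR (S n)) _ (fun n => 1 + 3 * / INR (S n))).
  - intro n. split.
    + apply trinomial_ratio_ge. lia.
    + apply Rle_trans with (1 := trinomial_ratio_le (S n) ltac:(lia)).
      apply Rplus_le_compat_l, Rmult_le_compat_l; [lra|].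
      apply Rinv_le_contravar; [apply lt_0_INR; lia|lra].
  - replace (Finite 1) with (Finite (1 - 3 * 0)) by (f_equal; ring).
    apply is_lim_seq_minus'; [apply is_lim_seq_const|].
    apply (is_lim_seq_scal_l _ 3 0), is_lim_seq_inv_S.
  - replace (Finite 1) with (Finite (1 + 3 * 0)) by (f_equal; ring).
    apply is_lim_seq_plus'; [apply is_lim_seq_const|].
    apply (is_lim_seq_scal_l _ 3 0), is_lim_seq_inv_S.
Qed.

(** * Asymptotics of the edge numbers *)

Lemma central_pos n : 0 < IZR (walks n 0).
Proof.
  apply IZR_lt. induction n as [|n IH]; [simpl; lia|].
  rewrite walks_S. generalize (walks_ge0 n (0 + 1)) (walks_ge0 n (0 - 1)). lia.
Qed.

Lemma is_lim_seq_inv_SS : is_lim_seq (fun n => / INR (S (S n))) 0.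
Proof. apply (is_lim_seq_incr_1 (fun n => / INR (S n))), is_lim_seq_inv_S. Qed.

Lemma is_lim_shift_quotient : is_lim_seq (fun n => INR (S (S n)) / INR (S n)) 1.
Proof.
  apply (is_lim_seq_ext (fun n => 1 + / INR (S n))).
  - intro n. rewrite (S_INR (S n)). field. apply not_0_INR. lia.
  - replace (Finite 1) with (Finite (1 + 0)) by (f_equal; ring).
    apply is_lim_seq_plus'; [apply is_lim_seq_const|apply is_lim_seq_inv_S].
Qed.

(** The powers of 3 contribute 1/3, and the two scales a square root tending to 1. *)
Lemma is_lim_central_quotient :
  is_lim_seq (fun n => IZR (walks (S n) 0) / IZR (walks (S (S n)) 0)) (/ 3).
Proof.
  apply (is_lim_seq_ext (fun n => / 3 * (trinomial_ratio (S n) / trinomial_ratio (S (S n)))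
                                  * sqrt (INR (S (S n)) / INR (S n)))).
  - intro n. unfold trinomial_ratio.
    assert (A := central_pos (S n)). assert (B := central_pos (S (S n))).
    assert (L1 := trinomial_scale_pos (S n) ltac:(lia)).
    assert (L2 := trinomial_scale_pos (S (S n)) ltac:(lia)).
    assert (N := lt_0_INR (S n) ltac:(lia)).
    assert (P := PI_RGT_0).
    replace (sqrt (INR (S (S n)) / INR (S n)))
      with (trinomial_scale (S (S n)) / trinomial_scale (S n)).
    + rewrite <- (tech_pow_Rmult 3 (S n)).
      assert (Q := pow_lt 3 (S n) ltac:(lra)). field. repeat split; lra.
    + unfold trinomial_scale. rewrite <- sqrt_div_alt by nra.
      f_equal. field. lra.
  - replace (Finite (/ 3)) with (Finite (/ 3 * (1 / 1) * sqrt 1))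
      by (f_equal; rewrite sqrt_1; field).
    apply is_lim_seq_mult'; [apply is_lim_seq_mult'; [apply is_lim_seq_const|]|].
    + apply is_lim_seq_div'; [apply is_lim_trinomial_ratio| |lra].
      apply (is_lim_seq_incr_1 (fun n => trinomial_ratio (S n))), is_lim_trinomial_ratio.
    + apply (is_lim_seq_continuous sqrt); [|apply is_lim_shift_quotient].
      apply continuity_pt_sqrt. lra.
Qed.

(** By [ballot], (n + 1) M_n is [walks (S n) 1], at most the central count. The excess of the latter
    is [walks n 1 - walks n 2], at most M_n. *)
Lemma motzkin_central_bounds n :
  INR (S n) * INR (Mnum n) <= IZR (walks (S n) 0) <= INR (S (S n)) * INR (Mnum n).
Proof.
  assert (B := ballot n 0).
  change (0 + 2)%Z with 2%Z in B. change (0 + 1)%Z with 1%Z in B.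
  assert (D0 := walks_decr (S n) 0 ltac:(lia)). assert (D1 := walks_decr n 0 ltac:(lia)).
  assert (S1 := walks_S n 1). assert (S0 := walks_S n 0). assert (O := walks_opp n 1).
  change (0 + 1)%Z with 1%Z in *. change (0 - 1)%Z with (-1)%Z in S0.
  change (- (1))%Z with (-1)%Z in O.
  change (1 + 1)%Z with 2%Z in S1. change (1 - 1)%Z with 0%Z in S1.
  rewrite !INR_IZR_INZ, <- !mult_IZR, Mnum_walks. unfold motzkin_walks.
  change (0 + 2)%Z with 2%Z.
  rewrite (Nat2Z.inj_succ (S n)).
  split; apply IZR_le; lia.
Qed.

Definition motzkin_ratio (n : nat) : R := INR (S n) * INR (Mnum n) / IZR (walks (S n) 0).

Lemma is_lim_motzkin_ratio : is_lim_seq motzkin_ratio 1.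
Proof.
  apply (is_lim_seq_le_le (fun n => 1 - / INR (S (S n))) _ (fun _ => 1)).
  - intro n. unfold motzkin_ratio. destruct (motzkin_central_bounds n) as [A B].
    assert (P := central_pos (S n)). assert (N := lt_0_INR (S n) ltac:(lia)).
    split.
    + apply Rle_div_r; [lra|].
      rewrite (S_INR (S n)) in *.
      apply (Rmult_le_reg_l (INR (S n) + 1)); [lra|].
      replace ((INR (S n) + 1) * ((1 - / (INR (S n) + 1)) * IZR (walks (S n) 0)))
        with (INR (S n) * IZR (walks (S n) 0)) by (field; lra).
      nra.
    + apply Rle_div_l; lra.
  - replace (Finite 1) with (Finite (1 - 0)) by (f_equal; ring).
    apply is_lim_seq_minus'; [apply is_lim_seq_const|apply is_lim_seq_inv_SS].
  - apply is_lim_seq_const.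
Qed.

Lemma ell_central_motzkin n :
  INR (ell (S n)) = IZR (walks (S n) 0) + IZR (walks n 0) - INR (Mnum (S n)) - INR (Mnum n).
Proof.
  assert (E := ell_trinomial (S n) ltac:(lia)).
  replace (S n - 1)%nat with n in E by lia. rewrite !Tnum_walks in E.
  rewrite !INR_IZR_INZ, E, minus_IZR, plus_IZR, minus_IZR. ring.
Qed.

(** The Motzkin terms are of order T_n / n, so the limit is that of 1 + T_{n-1} / T_n. *)
Lemma is_lim_ell_central :
  is_lim_seq (fun n => INR (ell (S (S n))) / IZR (walks (S (S n)) 0)) (4 / 3).
Proof.
  set (a := fun n => IZR (walks (S n) 0) / IZR (walks (S (S n)) 0)).
  (* The subtracted terms are M_{n+2} / T_{n+2} and M_{n+1} / T_{n+2}, expressed by quantities with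
     known limits. *)
  apply (is_lim_seq_ext (fun n => 1 + a n
     - motzkin_ratio (S (S n)) * / INR (S (S (S n))) / a (S n)
     - motzkin_ratio (S n) * / INR (S (S n)))).
  - intro n. rewrite ell_central_motzkin. unfold motzkin_ratio, a.
    assert (P1 := central_pos (S n)). assert (P2 := central_pos (S (S n))).
    assert (P3 := central_pos (S (S (S n)))).
    field. repeat split; try lra; apply not_0_INR; lia.
  - assert (A : is_lim_seq a (/ 3)) by apply is_lim_central_quotient.
    assert (A1 := proj1 (is_lim_seq_incr_1 _ _) A).
    assert (G := is_lim_motzkin_ratio).
    assert (G1 := proj1 (is_lim_seq_incr_1 _ _) G).
    assert (G2 := proj1 (is_lim_seq_incr_1 _ _) G1).
    assert (I := is_lim_seq_inv_SS).
    assert (I1 := proj1 (is_lim_seq_incr_1 _ _) I).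
    replace (Finite (4 / 3)) with (Finite (1 + / 3 - 1 * 0 / (/ 3) - 1 * 0))
      by (f_equal; field).
    apply is_lim_seq_minus'; [apply is_lim_seq_minus'|].
    + apply is_lim_seq_plus'; [apply is_lim_seq_const|exact A].
    + apply is_lim_seq_div'; [|exact A1|lra].
      apply is_lim_seq_mult'; [exact G2|exact I1].
    + apply is_lim_seq_mult'; [exact G1|exact I].
Qed.

Lemma ell_asymptotic :
  Un_cv (fun n => INR (ell n) / (2 * 3 ^ n / sqrt (3 * INR n * PI))) 1.
Proof.
  (* Dropping two terms avoids the zero denominator at [n = 0] and matches the shift in
     [is_lim_ell_central]. *)
  apply is_lim_seq_Reals. do 2 apply is_lim_seq_incr_1.
  apply (is_lim_seq_ext (fun n => INR (ell (S (S n))) / IZR (walks (S (S n)) 0)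
                                  * trinomial_ratio (S (S n)) * (3 / 4))).
  - intro n. unfold trinomial_ratio.
    replace (sqrt (3 * INR (S (S n)) * PI)) with (3 * trinomial_scale (S (S n))).
    + assert (L := trinomial_scale_pos (S (S n)) ltac:(lia)).
      assert (P := central_pos (S (S n))). assert (Q := pow_lt 3 (S (S n)) ltac:(lra)).
      field. repeat split; lra.
    + unfold trinomial_scale.
      replace (3 * INR (S (S n)) * PI) with (3 * 3 * (PI * INR (S (S n)) / 3)) by field.
      rewrite sqrt_mult_alt, sqrt_square by lra. reflexivity.
  - replace (Finite 1) with (Finite (4 / 3 * 1 * (3 / 4))) by (f_equal; field).
    apply is_lim_seq_mult'; [|apply is_lim_seq_const].
    apply is_lim_seq_mult'; [apply is_lim_ell_central|].
    exact (proj1 (is_lim_seq_incr_1 _ _) is_lim_trinomial_ratio).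
Qed.

(** Since M_n is asymptotic to T_{n+1} / (n + 1), the constant is 4/3 times the limit 1/3 of T_n /
    T_{n+1}. *)
Lemma edge_density_asymptotic :
  Un_cv (fun n => (INR (ell n) / INR (Mnum n)) / (4 / 9 * INR n)) 1.
Proof.
  apply is_lim_seq_Reals. do 2 apply is_lim_seq_incr_1.
  set (a := fun n => IZR (walks (S n) 0) / IZR (walks (S (S n)) 0)).
  apply (is_lim_seq_ext (fun n => INR (ell (S (S n))) / IZR (walks (S (S n)) 0)
     * a (S n) / motzkin_ratio (S (S n)) * (INR (S (S (S n))) / INR (S (S n))) * (9 / 4))).
  - intro n. unfold a, motzkin_ratio.
    assert (P2 := central_pos (S (S n))). assert (P3 := central_pos (S (S (S n)))).
    assert (N2 := lt_0_INR (S (S n)) ltac:(lia)).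
    assert (N3 := lt_0_INR (S (S (S n))) ltac:(lia)).
    destruct (motzkin_central_bounds (S (S n))) as [_ B].
    (* A zero Motzkin number would contradict the positive lower bound in [B]. *)
    assert (M : INR (Mnum (S (S n))) <> 0) by (intro Z; rewrite Z in B; lra).
    field. repeat split; trivial; lra.
  - assert (A1 := proj1 (is_lim_seq_incr_1 _ _) is_lim_central_quotient).
    assert (G2 := proj1 (is_lim_seq_incr_1 _ _)
                    (proj1 (is_lim_seq_incr_1 _ _) is_lim_motzkin_ratio)).
    assert (Q1 := proj1 (is_lim_seq_incr_1 _ _) is_lim_shift_quotient).
    replace (Finite 1) with (Finite (4 / 3 * / 3 / 1 * 1 * (9 / 4))) by (f_equal; field).
    apply is_lim_seq_mult'; [|apply is_lim_seq_const].
    apply is_lim_seq_mult'; [|exact Q1].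
    apply is_lim_seq_div'; [|exact G2|lra].
    apply is_lim_seq_mult'; [apply is_lim_ell_central|exact A1].
Qed.

Local Close Scope R_scope.

Theorem mainTheorem8 :
  (* generating series: with S = sqrt(1-2x-3x^2) (the formal square root with S(0)=1),
     2x^2 S * L(x) = (1+x)(1 - 2x - x^2 - (1-x) S) *)
  (exists s : fps,
      s 0%nat = 1%Z /\
      (forall k, fps_mul s s k = fps_poly [1%Z; (-2)%Z; (-3)%Z] k) /\
      (forall k,
         fps_mul (fps_mul (fps_poly [0%Z; 0%Z; 2%Z]) s) ell_series k =
         fps_mul (fps_poly [1%Z; 1%Z])
                 (fps_sub (fps_poly [1%Z; (-2)%Z; (-1)%Z])
                          (fps_mul (fps_poly [1%Z; (-1)%Z]) s)) k))
  (* (i) *)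
  /\ (forall n : nat, (1 <= n)%nat ->
        Z.of_nat (ell n) =
        (Z.of_nat (Tnum n) - Z.of_nat (Mnum n)
         + Z.of_nat (Tnum (n - 1)) - Z.of_nat (Mnum (n - 1)))%Z)
  (* (ii) *)
  /\ (forall n : nat, (3 <= n)%nat ->
        ell n = (trin n (n - 2) + trin (n - 1) (n - 3))%nat)
  (* (iii) *)
  /\ (forall n : nat, (1 <= n)%nat ->
        INR (ell n) =
        (2 / INR n *
         sum_f_R0 (fun k => Binomial.C n k * Binomial.C (n - k) k
                            * INR (k * (n - k)) / INR (k + 1)) (n / 2))%R)
  (* asymptotics *)
  /\ Un_cv (fun n => (INR (ell n) / (2 * 3 ^ n / sqrt (3 * INR n * PI)))%R) 1%R
  /\ Un_cv (fun n => ((INR (ell n) / INR (Mnum n)) / (4 / 9 * INR n))%R) 1%R.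
Proof.
  split; [exact ell_generating_series|].
  split; [exact ell_trinomial|].
  split; [exact ell_trin|].
  split; [exact ell_binomial_sum|].
  split; [exact ell_asymptotic|exact edge_density_asymptotic].
Qed.
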